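(* Let $(\Gamma,\pi)$ be a weighted graph with vertex set $G$ and let $(\theta_x)_{x\in G}$ be positive vertex weights such that $\sum_{x\in U}\theta_x=\infty$ for every infinite connected $U\subset G$. If there exists a metric $\rho$ on $G$ adapted to $\mathcal{L}_\theta$ such that $VG(\Gamma,\pi,\theta,\rho)=0$, then the bottom of the essential spectrum of $-\mathcal{L}_\theta$ satisfies $\lambda^{ess}_0(\Gamma,\pi,\theta)=0$.
   Context: Graph: $\Gamma=(G,E)$ is an unoriented, connected, countably infinite, locally finite graph without loops or multiple edges; $x\sim y$ means $\{x,y\}\in E$. A subset $U\subset G$ is connected if it induces a connected subgraph. Edge weights: $\pi_{xy}=\pi_{yx}\ge 0$ for $x,y\in G$, with $\pi_{xy}>0$ if and only if $\{x,y\}\in E$; $(\Gamma,\pi)$ is then called a weighted graph. Operator: $L^2(\theta)$ is the real Hilbert space with inner product $\langle f,g\rangle_{L^2(\theta)}=\sum_{x\in G}f(x)g(x)\theta_x$. The operator $\mathcal{L}_\theta$ is given by $(\mathcal{L}_\theta f)(x)=\frac{1}{\theta_x}\sum_{y\sim x}\pi_{xy}(f(y)-f(x))$ on the domain $\{f\in L^2(\theta):\mathcal{L}_\theta f\in L^2(\theta)\}$. Under the stated condition on $\theta$, $-\mathcal{L}_\theta$ is a nonnegative self-adjoint operator; it is minus the generator of the Dirichlet form $\mathcal{E}(f,g)=\frac12\sum_{x,y\in G}\pi_{xy}(f(y)-f(x))(g(y)-g(x))$ whose domain $\mathcal{D}(\mathcal{E})$ is the closure of the finitely supported functions $C_c(G)$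 in the norm $(\|f\|_{L^2(\theta)}^2+\mathcal{E}(f,f))^{1/2}$. It may be unbounded. Adapted metric: a metric $\rho$ on $G$ is adapted to $\mathcal{L}_\theta$ on $(\Gamma,\pi)$ if $\frac{1}{\theta_x}\sum_{y\sim x}\pi_{xy}\rho^2(x,y)\le 1$ for all $x\in G$, and there is $c_\rho>0$ such that $\rho(x,y)\le c_\rho$ whenever $x\sim y$. Volume growth: $B_\rho(x_0,r)=\{x\in G:\rho(x_0,x)\le r\}$, $V_\rho(x_0,r)=\sum_{x\in B_\rho(x_0,r)}\theta_x\in(0,\infty]$, and $VG(\Gamma,\pi,\theta,\rho)=\limsup_{r\to\infty}\frac1r\log V_\rho(x_0,r)$, which does not depend on $x_0\in G$. Spectrum: the essential spectrum of $-\mathcal{L}_\theta$ consists of the points of its spectrum that are accumulation points of the spectrum or isolated eigenvalues of infinite multiplicity; $\lambda_0^{ess}(\Gamma,\pi,\theta)$ is its infimum, equal to $+\infty$ if the essential spectrum is empty. *)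

(* Defs.v *)
From HB Require Import structures.
From mathcomp Require Import all_boot all_order all_algebra.
From mathcomp Require Import all_classical all_reals all_analysis.

Set Implicit Arguments.
Unset Strict Implicit.
Unset Printing Implicit Defensive.

Import Order.TTheory GRing.Theory Num.Theory.
Import numFieldNormedType.Exports.

Local Open Scope classical_set_scope.
Local Open Scope ring_scope.

Definition graph_connected (V : eqType) (e : rel V) (U : set V) : Prop :=
  forall x y : V, U x -> U y ->
    exists p : seq V,
      [/\ path e x p, last x p = y & forall z : V, z \in p -> U z].

(* Together with [V : countType], [wg_infinite] says that the vertex set is
   countably infinite. *)
Record weighted_graph (R : realType) (V : countType) := WeightedGraph {
  adj : rel V;
  adj_sym : symmetric adj;
  adj_irr : irreflexive adj;
  wg_infinite : infinite_set [set: V];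
  wg_locally_finite : forall x : V, finite_set [set y | adj x y];
  wg_connected : graph_connected adj [set: V];
  weight : V -> V -> R;
  weight_sym : forall x y : V, weight x y = weight y x;
  weight_ge0 : forall x y : V, 0 <= weight x y;
  weight_gt0 : forall x y : V, 0 < weight x y <-> adj x y
}.

(* Spectral notions for an operator [A] with domain [D], acting in the
   subspace [H] of an ambient space [E]; [N] is the norm of [H].  Scalars are
   real: for a self-adjoint operator on a real Hilbert space the spectrum of
   the complexification is real and coincides with the set below. *)
Section Spectrum.
Context {R : realType} {E : lmodType R}.
Variables (H : set E) (N : E -> R) (D : set E) (A : E -> E).

Definition resolvent_set : set R :=
  [set l | (forall g : E, H g -> exists! f : E, D f /\ A f - l *: f = g) /\
           (exists C : R, forall f : E, D f -> N f <= C * N (A f - l *: f))].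

Definition spectrum : set R := ~` resolvent_set.

Definition eigenspace (l : R) : set E := [set f | D f /\ A f = l *: f].

Definition infinite_multiplicity (l : R) : Prop :=
  forall n : nat, exists f : 'I_n -> E,
    (forall i, eigenspace l (f i)) /\
    (forall c : 'I_n -> R, \sum_(i < n) c i *: f i = 0 -> forall i, c i = 0).

Definition essential_spectrum : set R :=
  [set l | spectrum l /\
           (limit_point spectrum l \/
            isolated spectrum l /\ infinite_multiplicity l)].

(* [ereal_inf set0 = +oo] *)
Definition ess_spectrum_bottom : \bar R := ereal_inf (EFin @` essential_spectrum).

End Spectrum.

Section WeightedLaplacian.
Context {R : realType} {V : countType}.
Variables (G : weighted_graph R V) (theta : V -> R).

Definition laplacian (f : V -> R) : V -> R := fun x =>
  (theta x)^-1 * \sum_(y \in [set y | adj G x y]) weight G x y * (f y - f x).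

Definition l2_sqnorm (f : V -> R) : \bar R :=
  \esum_(x in [set: V]) (f x ^+ 2 * theta x)%:E.

Definition l2 : set (V -> R) := [set f | (l2_sqnorm f < +oo)%E].

Definition l2_norm (f : V -> R) : R := Num.sqrt (fine (l2_sqnorm f)).

Definition laplacian_dom : set (V -> R) := [set f | l2 f /\ l2 (laplacian f)].

Definition lambda0_ess : \bar R :=
  ess_spectrum_bottom l2 l2_norm laplacian_dom (fun f => - laplacian f).

Definition is_metric (rho : V -> V -> R) : Prop :=
  [/\ forall x y : V, 0 <= rho x y,
      forall x y : V, rho x y = 0 <-> x = y,
      forall x y : V, rho x y = rho y x &
      forall x y z : V, rho x z <= rho x y + rho y z].

Definition adapted (rho : V -> V -> R) : Prop :=
  (forall x : V,
     (theta x)^-1 * \sum_(y \in [set y | adj G x y]) weight G x y * rho x y ^+ 2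
       <= 1) /\
  (exists2 c : R, 0 < c & forall x y : V, adj G x y -> rho x y <= c).

Definition volume (rho : V -> V -> R) (x0 : V) (r : R) : \bar R :=
  \esum_(x in [set x | rho x0 x <= r]) (theta x)%:E.

(* The growth rate does not depend on the base point [x0]. *)
Definition volume_growth (rho : V -> V -> R) (x0 : V) : \bar R :=
  limf_esup (fun r : R => (r^-1)%:E * lne (volume rho x0 r))%E (pinfty_nbhs R).

End WeightedLaplacian.

(* Main.v *)
Require Import Defs.
From HB Require Import structures.
From mathcomp Require Import all_boot all_order all_algebra.
From mathcomp Require Import ring lra.
From mathcomp Require Import all_classical all_reals all_analysis.

Set Implicit Arguments.
Unset Strict Implicit.
Unset Printing Implicit Defensive.

Import Order.TTheory GRing.Theory Num.Theory.
Import numFieldNormedType.Exports.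

Local Open Scope classical_set_scope.
Local Open Scope ring_scope.

(* Write A for minus the Laplacian.  The maximum principle shows that A + s is
   injective on the maximal domain for every s >= 0, because a nonzero solution
   would be bounded below in absolute value on an infinite connected set, which
   has infinite measure.  Solving (A + s) f = g for s > 0 by minimisation over
   finitely supported functions then shows that A is symmetric and nonnegative
   on its maximal domain and that the spectrum lies in [0, +oo[.

   If R is a radius at which the volume less than doubles, the function
   min(h, (R - rho x0)_+), cut down to finitely many components of the ball of
   radius R (these are finite), has Rayleigh quotient O(1 / h^2).  Hence 0 is in
   the spectrum.  It is not isolated: if ]0, e[ met no spectrum, then A >= e on
   the range of A, which is dense since A is injective, contradicting the small
   Rayleigh quotients.  So 0 is a limit point of the spectrum. *)

(** * Symmetric forms and the bottom of the spectrum *)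

(** Evaluate at the minimiser [t = - b / c]. If [c = 0] the polynomial is affine, and unless [b = 0]
    it takes the value -1. *)
Lemma discriminant_le (R : realFieldType) (a b c : R) : 0 <= c ->
  (forall t, 0 <= a + 2 * t * b + t ^+ 2 * c) -> b ^+ 2 <= c * a.
Proof.
rewrite le_eqVlt => /predU1P[<-|c0] h.
  have [->|b0] := eqVneq b 0; first by rewrite expr0n/= mul0r.
  have := h (- (a + 1) / (2 * b)).
  suff -> : a + 2 * (- (a + 1) / (2 * b)) * b +
      (- (a + 1) / (2 * b)) ^+ 2 * 0 = -1 by rewrite ler0N1.
  by field.
have := h (- b / c).
have -> : a + 2 * (- b / c) * b + (- b / c) ^+ 2 * c = a - b ^+ 2 / c.
  by field; rewrite gt_eqF.
by rewrite subr_ge0 ler_pdivrMr// mulrC.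
Qed.

Lemma sqr_le_cvg0 (R : realType) (x y : nat -> R) :
  y n @[n --> \oo] --> (0 : R) -> (forall n, x n ^+ 2 <= y n) ->
  x n @[n --> \oo] --> (0 : R).
Proof.
move=> y0 xy; apply/norm_cvg0P.
have : Num.sqrt (y n) @[n --> \oo] --> (0 : R).
  by rewrite -sqrtr0; apply: continuous_cvg; [exact: sqrt_continuous|].
apply: squeeze_cvgr (cvg_cst 0); apply: nearW => n /=.
by rewrite normr_ge0/= -sqrtr_sqr ler_wsqrtr.
Qed.

(** Model: [H] is the Hilbert space, [A] is minus the Laplacian, [D] its maximal domain and [C] the
    finitely supported functions. [A_adj_dom] expresses maximality: the adjoint of [A] restricted to
    [C] is contained in [A] on [D]. *)
Section SpectrumBottom.
Context {R : realType} {E : lmodType R}.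
Variables (H D C : set E) (ip : E -> E -> R) (A : E -> E).

Hypothesis CD : C `<=` D.
Hypothesis DH : D `<=` H.
Hypothesis AH : forall f, D f -> H (A f).
Hypothesis C0 : C 0.
Hypothesis H_lin : forall a f g, H f -> H g -> H (a *: f + g).
Hypothesis D_lin : forall a f g, D f -> D g -> D (a *: f + g).
Hypothesis C_lin : forall a f g, C f -> C g -> C (a *: f + g).
Hypothesis A_lin : forall a f g, A (a *: f + g) = a *: A f + A g.
Hypothesis ipC : forall f g, ip f g = ip g f.
Hypothesis ip_lin : forall a f g h, H f -> H g -> H h ->
  ip (a *: f + g) h = a * ip f h + ip g h.
Hypothesis ip_ge0 : forall f, H f -> 0 <= ip f f.
Hypothesis ip_eq0 : forall f, H f -> ip f f = 0 -> f = 0.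
Hypothesis H_complete : forall u : nat -> E, (forall n, H (u n)) ->
  (forall e, 0 < e -> exists N, forall n m, (N <= n)%N -> (N <= m)%N ->
    ip (u n - u m) (u n - u m) <= e) ->
  exists2 f, H f & ip (u n - f) (u n - f) @[n --> \oo] --> 0.
Hypothesis A_adj : forall f g, D f -> C g -> ip (A f) g = ip f (A g).
Hypothesis A_adj_dom : forall f g, H f -> H g ->
  (forall h, C h -> ip f (A h) = ip g h) -> D f /\ A f = g.
Hypothesis A_form_ge0 : forall f, C f -> 0 <= ip (A f) f.

Let CH f : C f -> H f. Proof. by move=> /CD/DH. Qed.
Let H0 : H 0. Proof. exact: CH. Qed.
Let D0 : D 0. Proof. exact: CD. Qed.
Let HZ a f : H f -> H (a *: f).
Proof. by move=> Hf; rewrite -[_ *: _]addr0; exact: H_lin. Qed.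
Let DZ a f : D f -> D (a *: f).
Proof. by move=> Hf; rewrite -[_ *: _]addr0; exact: D_lin. Qed.
Let CZ a f : C f -> C (a *: f).
Proof. by move=> Hf; rewrite -[_ *: _]addr0; exact: C_lin. Qed.
Let HD f g : H f -> H g -> H (f + g).
Proof. by move=> ? ?; rewrite -[f]scale1r; exact: H_lin. Qed.
Let DD f g : D f -> D g -> D (f + g).
Proof. by move=> ? ?; rewrite -[f]scale1r; exact: D_lin. Qed.
Let CC f g : C f -> C g -> C (f + g).
Proof. by move=> ? ?; rewrite -[f]scale1r; exact: C_lin. Qed.
Let HN f : H f -> H (- f).
Proof. by move=> ?; rewrite -scaleN1r; exact: HZ. Qed.
Let DN f : D f -> D (- f).
Proof. by move=> ?; rewrite -scaleN1r; exact: DZ. Qed.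
Let CN f : C f -> C (- f).
Proof. by move=> ?; rewrite -scaleN1r; exact: CZ. Qed.
Hint Resolve CD DH AH CH HZ DZ CZ HD DD CC HN DN CN : core.

Let AD f g : A (f + g) = A f + A g.
Proof. by rewrite -[f in LHS]scale1r A_lin scale1r. Qed.
Let A0 : A 0 = 0.
Proof. by apply: (addIr (A 0)); rewrite -AD !add0r. Qed.
Let AZ a f : A (a *: f) = a *: A f.
Proof. by rewrite -[_ *: f]addr0 A_lin A0 addr0. Qed.
Let AN f : A (- f) = - A f.
Proof. by rewrite -scaleN1r AZ scaleN1r. Qed.

Let ipDl f g h : H f -> H g -> H h -> ip (f + g) h = ip f h + ip g h.
Proof. by move=> ? ? ?; rewrite -[f in LHS]scale1r ip_lin// mul1r. Qed.
Let ip0l h : H h -> ip 0 h = 0.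
Proof. by move=> ?; apply: (addIr (ip 0 h)); rewrite -ipDl// !add0r. Qed.
Let ipZl a f h : H f -> H h -> ip (a *: f) h = a * ip f h.
Proof. by move=> ? ?; rewrite -[_ *: f]addr0 ip_lin// ip0l// addr0. Qed.
Let ipNl f h : H f -> H h -> ip (- f) h = - ip f h.
Proof. by move=> ? ?; rewrite -scaleN1r ipZl// mulN1r. Qed.
Let ipDr f g h : H f -> H g -> H h -> ip f (g + h) = ip f g + ip f h.
Proof. by move=> ? ? ?; rewrite ipC ipDl// !(ipC f). Qed.
Let ipZr a f h : H f -> H h -> ip f (a *: h) = a * ip f h.
Proof. by move=> ? ?; rewrite ipC ipZl// ipC. Qed.
Let ipNr f h : H f -> H h -> ip f (- h) = - ip f h.
Proof. by move=> ? ?; rewrite ipC ipNl// ipC. Qed.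
Let ip0r h : H h -> ip h 0 = 0. Proof. by move=> ?; rewrite ipC ip0l. Qed.

Ltac ipx := rewrite ?(AD, AZ, AN, ipDl, ipZl, ipNl, ipDr, ipZr, ipNr);
  [ | by auto 8..].

Lemma ip_CauchySchwarz f g : H f -> H g -> ip f g ^+ 2 <= ip f f * ip g g.
Proof.
move=> Hf Hg; apply: discriminant_le; first exact: ip_ge0.
move=> t; have : 0 <= ip (g + t *: f) (g + t *: f) by apply: ip_ge0; auto.
by ipx; rewrite (ipC g f); lra.
Qed.

Let cv (u : nat -> E) f := ip (u n - f) (u n - f) @[n --> \oo] --> (0 : R).

Lemma ip_cvg0 (u v : nat -> E) (M : R) :
  (forall n, H (u n)) -> (forall n, H (v n)) ->
  ip (u n) (u n) @[n --> \oo] --> (0 : R) ->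
  ip (v n) (v n) @[n --> \oo] --> M ->
  ip (u n) (v n) @[n --> \oo] --> (0 : R).
Proof.
move=> Hu Hv u0 vM.
apply: (@sqr_le_cvg0 _ _ (fun n => ip (u n) (u n) * ip (v n) (v n))).
  by rewrite -[X in _ --> X](mul0r M); exact: cvgM.
by move=> n; exact: ip_CauchySchwarz.
Qed.

Lemma ip_cvg (u v : nat -> E) f g :
  (forall n, H (u n)) -> (forall n, H (v n)) -> H f -> H g ->
  cv u f -> cv v g -> ip (u n) (v n) @[n --> \oo] --> ip f g.
Proof.
move=> Hu Hv Hf Hg uf vg.
have h1 : ip (u n - f) g @[n --> \oo] --> (0 : R).
  by apply: (ip_cvg0 (M := ip g g)) => //; [auto|exact: cvg_cst].
have h2 : ip (v n - g) f @[n --> \oo] --> (0 : R).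
  by apply: (ip_cvg0 (M := ip f f)) => //; [auto|exact: cvg_cst].
have h3 : ip (u n - f) (v n - g) @[n --> \oo] --> (0 : R).
  by apply: (ip_cvg0 (M := 0)) => //; auto.
(* Expand around the limits; each of the three error terms tends to 0 by Cauchy-Schwarz. *)
have -> : (fun n => ip (u n) (v n)) =
    (fun n => ip (u n - f) g + ip (v n - g) f + ip (u n - f) (v n - g) + ip f g).
  apply/funext => n; ipx; rewrite (ipC (v n) f) (ipC g f); ring.
rewrite -[X in _ --> X]add0r; apply: cvgD; last exact: cvg_cst.
by rewrite -[X in _ --> X]add0r -[X in X + _]add0r; apply: cvgD => //; apply: cvgD.
Qed.

Lemma cv_cst f : cv (fun=> f) f.
Proof. by rewrite /cv subrr ip0r//; exact: cvg_cst. Qed.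

Lemma ip_cauchy_cvg (u : nat -> E) (K : R) : (forall n, H (u n)) ->
  (forall n m, ip (u n - u m) (u n - u m) <= K * (n.+1%:R^-1 + m.+1%:R^-1)) ->
  exists2 f, H f & cv u f.
Proof.
move=> Hu uK; apply: H_complete => // e e0.
have : (K * (n.+1%:R^-1 + n.+1%:R^-1)) @[n --> \oo] --> (0 : R).
  rewrite -[X in _ --> X](mulr0 K) -[X in _ * X]addr0.
  by apply: cvgMr; apply: cvgD; exact: cvg_harmonic.
have K0 : 0 <= K.
  have : 0 <= ip (u 0%N - u 0%N) (u 0%N - u 0%N) by apply: ip_ge0; auto.
  by move=> /le_trans /(_ (uK _ _)); rewrite pmulr_lge0// invr1.
move=> /cvgrPdist_le /(_ e e0) [N _ hN]; exists N => n m Nn Nm.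
apply: (le_trans (uK n m)); apply: (@le_trans _ _ (K * (N.+1%:R^-1 + N.+1%:R^-1))).
  by rewrite ler_wpM2l// lerD// lef_pV2 ?posrE ?ltr0n// ler_nat ltnS.
have /= := hN N (leqnn N); rewrite sub0r normrN; exact: le_trans (ler_norm _).
Qed.

(* Riesz representation: [u] minimises [Q f f - 2 <g, f>] along [C], where
   [Q f h = <A f, h> + s <f, h>]; the last clause is its approximate
   Euler-Lagrange equation. *)
Lemma resolvent_approx s g : 0 < s -> H g -> exists (u : nat -> E) f,
  [/\ forall n, C (u n), D f, A f + s *: f = g, cv u f &
      forall n h, C h -> (ip (A (u n)) h + s * ip (u n) h - ip g h) ^+ 2 <=
        (ip (A h) h + s * ip h h) * n.+1%:R^-1].
Proof.
move=> s0 Hg.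
pose J f := ip (A f) f + s * ip f f - 2 * ip g f.
pose S := [set J f | f in C].
have hS : has_inf S.
  split; first by exists (J 0), 0.
  (* Completing the square, [s * J f >= <s f - g, s f - g> - <g, g>]. *)
  exists (- (ip g g / s)) => _ [f Cf <-].
  rewrite lerNl ler_pdivlMr// mulrC -subr_ge0.
  have h1 : 0 <= ip (s *: f - g) (s *: f - g) by apply: ip_ge0; auto.
  have h2 := A_form_ge0 Cf.
  have {h1} : 0 <= s * (s * ip f f) - s * ip g f - (s * ip g f - ip g g).
    by move: h1; ipx; rewrite (ipC g f); lra.
  by rewrite /J; nra.
have /choice[u hu] : forall n : nat, exists f, C f /\ J f < inf S + n.+1%:R^-1.
  move=> n; have n0 : 0 < n.+1%:R^-1 :> R by [].
  by have [_ [f Cf <-] hf] := inf_adherent n0 hS; exists f.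
(* For all [t], [J (u n + t h) >= inf S > J (u n) - 1 / (n + 1)]. The difference is a quadratic
   polynomial in [t], and its discriminant gives the estimate. *)
have EL n h : C h -> (ip (A (u n)) h + s * ip (u n) h - ip g h) ^+ 2 <=
    (ip (A h) h + s * ip h h) * n.+1%:R^-1.
  move=> Ch; have [Cu Ju] := hu n; apply: discriminant_le.
    by rewrite addr_ge0 ?A_form_ge0// mulr_ge0 ?ip_ge0 ?ltW//; auto.
  move=> t; have : inf S <= J (u n + t *: h).
    by apply: ge_inf; [case: hS|exists (u n + t *: h) => //; auto].
  move: Ju; rewrite /J; ipx.
  rewrite (ipC (A h) (u n)) -(A_adj (CD Cu) Ch) (ipC h (u n)) => h1 h2.
  have {h1 h2} := lt_le_trans h1 (lerD h2 (lexx _)); move: (_^-1) => q; lra.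
have Cu n : C (u n) by case: (hu n).
have [||f Hf uf] := @ip_cauchy_cvg u (2 / s); first by auto.
  move=> n m; have [d dE] : exists d, d = u n - u m by exists (u n - u m).
  rewrite -dE; have Cd : C d by rewrite dE; auto.
  have := EL n _ Cd; have := EL m _ Cd.
  set q := ip (A d) d + s * ip d d.
  set a := n.+1%:R^-1; set b := m.+1%:R^-1.
  have a0 : 0 <= a by rewrite invr_ge0.
  have b0 : 0 <= b by rewrite invr_ge0.
  set x := ip (A (u m)) d + _ - _; set y := ip (A (u n)) d + _ - _.
  have qE : q = y - x.
    have -> : q = ip (A (u n - u m)) d + s * ip (u n - u m) d by rewrite -dE.
    by ipx; rewrite /x /y; ring.
  rewrite qE => hx hy.
  (* Here [x] and [y] are the Euler-Lagrange residuals of [u m] and [u n] tested on [d], so [q^2 =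
     (y - x)^2 <= 2 x^2 + 2 y^2 <= 2 q (a + b)]. *)
  have yx : y - x <= 2 * (a + b).
    rewrite leNgt; apply/negP => h; have yx0 : 0 < y - x by lra.
    have : 0 <= (x + y) ^+ 2 by exact: sqr_ge0.
    nra.
  have : s * ip d d <= y - x.
    by rewrite -qE /q lerDr A_form_ge0.
  by rewrite mulrAC ler_pdivlMr// mulrC => /le_trans; exact.
(* Moving [A] onto [h] makes the residual continuous in [u n], so it vanishes in the limit. *)
have weak h : C h -> ip f (A h) = ip (g - s *: f) h.
  move=> Ch.
  have l1 : ip (u n) (A h + s *: h) @[n --> \oo] --> ip f (A h + s *: h).
    by apply: ip_cvg => //; auto using cv_cst.
  have l2 : ip (u n) (A h + s *: h) - ip g h @[n --> \oo] --> (0 : R).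
    pose q := ip (A h) h + s * ip h h.
    apply: (@sqr_le_cvg0 _ _ (fun n => q * n.+1%:R^-1)).
      by rewrite -[X in _ --> X](mulr0 q); apply: cvgMr; exact: cvg_harmonic.
    move=> n.
    by have := EL n h Ch; ipx; rewrite -(A_adj (CD (Cu n)) Ch).
  have l3 : ip (u n) (A h + s *: h) - ip g h @[n --> \oo] -->
      ip f (A h + s *: h) - ip g h.
    by apply: cvgB => //; exact: cvg_cst.
  have : 0 = ip f (A h + s *: h) - ip g h.
    exact: (cvg_unique (@Rhausdorff R) l2 l3).
  by ipx => e; lra.
have [Df Af] : D f /\ A f = g - s *: f by apply: A_adj_dom => //; auto.
by exists u, f; split => //; rewrite Af subrK.
Qed.

(** For [s > 0] this identifies a given element of [D] with the limit of its minimising sequence;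
    for [s = 0] it makes the range of [A] dense. *)
Hypothesis A_inj : forall s f, 0 <= s -> D f -> A f + s *: f = 0 -> f = 0.

Lemma resolvent_unique s f g : 0 <= s -> D f -> D g ->
  A f + s *: f = A g + s *: g -> f = g.
Proof.
move=> s0 Df Dg fg; apply: subr0_eq; apply: (A_inj s0); first by auto.
by rewrite AD AN scalerBr addrACA -opprD fg subrr.
Qed.

(** By uniqueness [f] is the solution of [(A + 1) h = (A + 1) f] found by minimisation. [A (u n)]
    need not converge; the last two clauses replace this by allowing tests against [h] that vary
    with [n]. *)
Lemma dom_approx f : D f -> exists u : nat -> E,
  [/\ forall n, C (u n), cv u f,
      forall n h, C h -> (ip (A (u n)) h + ip (u n) h - ip (A f + f) h) ^+ 2 <=
        (ip (A h) h + ip h h) * n.+1%:R^-1 &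
      (ip (A (u n)) (u n) + ip (u n) (u n)) * n.+1%:R^-1 @[n --> \oo]
        --> (0 : R)].
Proof.
move=> Df; have Hf : H (A f + f) by auto.
have [u [h [Cu Dh Ah uh EL]]] := @resolvent_approx 1 (A f + f) ltr01 Hf.
have fh : h = f by apply: (@resolvent_unique 1) => //; rewrite Ah scale1r.
rewrite {}fh {h Ah Dh} in uh.
have {}EL n h : C h -> (ip (A (u n)) h + ip (u n) h - ip (A f + f) h) ^+ 2 <=
        (ip (A h) h + ip h h) * n.+1%:R^-1.
  by move=> Ch; have := EL n h Ch; rewrite !mul1r.
exists u; split => //.
have Hu n : H (u n) by auto.
have l1 : ip (A f + f) (u n) @[n --> \oo] --> ip (A f + f) f.
  by apply: ip_cvg => //; auto using cv_cst.
(* With [q] the form at [u n] and [c = <A f + f, u n>], testing with [u n] gives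
   [(q - c)^2 <= q / (n + 1) <= q], whence [q <= 2 c + 1], which is bounded. *)
have l2 : (2 * ip (A f + f) (u n) + 1) * n.+1%:R^-1 @[n --> \oo] --> (0 : R).
  rewrite -[X in _ --> X](mulr0 (2 * ip (A f + f) f + 1)).
  apply: cvgM; last exact: cvg_harmonic.
  by apply: cvgD; [exact: cvgMr|exact: cvg_cst].
move: l2; apply: squeeze_cvgr (cvg_cst 0); apply: nearW => n /=.
have q0 : 0 <= ip (A (u n)) (u n) + ip (u n) (u n).
  by rewrite addr_ge0 ?A_form_ge0 ?ip_ge0.
rewrite mulr_ge0//= ler_wpM2r//.
have := EL n _ (Cu n); move: q0; set q := _ + ip (u n) (u n) => q0.
have : q * n.+1%:R^-1 <= q by rewrite ler_piMr// invf_le1// ler1n.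
move: (_ * _^-1) (ip _ _) => x c xq h.
rewrite leNgt; apply/negP => h2.
have c0 : 0 <= c ^+ 2 by exact: sqr_ge0.
have hq : 0 <= q * (q - (2 * c + 1)) by rewrite mulr_ge0// subr_ge0 ltW.
have cc : c = 0.
  by apply/eqP; rewrite -(sqrf_eq0 c) eq_le c0 andbT; nra.
by move: h2 h xq; rewrite cc; nra.
Qed.

(** Testing the approximate equation with [u n] itself shows that [<A (u n), u n>] tends to
    [<A f, f>]. *)
Lemma dom_form_ge0 f : D f -> 0 <= ip (A f) f.
Proof.
move=> Df; have [u [Cu uf EL q0]] := dom_approx Df.
have Hu n : H (u n) by auto.
have l1 : ip (A f + f) (u n) @[n --> \oo] --> ip (A f + f) f.
  by apply: ip_cvg => //; auto using cv_cst.
have l2 : ip (u n) (u n) @[n --> \oo] --> ip f f by apply: ip_cvg; auto.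
have l3 := sqr_le_cvg0 q0 (fun n => EL n _ (Cu n)).
have -> : ip (A f) f = ip (A f + f) f - ip f f + 0 by ipx; ring.
have l4 : ip (A f + f) (u n) - ip (u n) (u n) +
    (ip (A (u n)) (u n) + ip (u n) (u n) - ip (A f + f) (u n)) @[n --> \oo] -->
    ip (A f + f) f - ip f f + 0.
  by apply: cvgD => //; exact: cvgB.
have l0 : (0 : R) @[n --> \oo] --> (0 : R) by exact: cvg_cst.
apply: (ler_cvg_to l0 l4); apply: nearW => n /=.
have := A_form_ge0 (Cu n); lra.
Qed.

(** Test the equation of [u n] with [v n] and that of [v n] with [u n]: symmetry on [C] cancels the
    main terms, and both residuals tend to 0. *)
Lemma dom_symmetric f g : D f -> D g -> ip (A f) g = ip f (A g).
Proof.
move=> Df Dg; have [u [Cu uf ELu qu]] := dom_approx Df.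
have [v [Cv vg ELv qv]] := dom_approx Dg.
have Hu n : H (u n) by auto.
have Hv n : H (v n) by auto.
have l1 : ip (A f + f) (v n) @[n --> \oo] --> ip (A f + f) g.
  by apply: ip_cvg => //; auto using cv_cst.
have l2 : ip (A g + g) (u n) @[n --> \oo] --> ip (A g + g) f.
  by apply: ip_cvg => //; auto using cv_cst.
have l3 := sqr_le_cvg0 qv (fun n => ELu n _ (Cv n)).
have l4 := sqr_le_cvg0 qu (fun n => ELv n _ (Cu n)).
have l5 : ip (A f + f) (v n) - ip (A g + g) (u n) @[n --> \oo] --> (0 : R).
  have -> : (fun n => ip (A f + f) (v n) - ip (A g + g) (u n)) = (fun n =>
      (ip (A (v n)) (u n) + ip (v n) (u n) - ip (A g + g) (u n)) -
      (ip (A (u n)) (v n) + ip (u n) (v n) - ip (A f + f) (v n))).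
    apply/funext => n; rewrite (A_adj (CD (Cv n)) (Cu n)).
    rewrite (ipC (v n) (A _)) (ipC (v n) (u n)); ring.
  by rewrite -[X in _ --> X](subr0 0); exact: cvgB.
have : 0 = ip (A f + f) g - ip (A g + g) f.
  exact: (cvg_unique (@Rhausdorff R) l5 (cvgB l1 l2)).
ipx.
rewrite (ipC (A g) f) (ipC g f) => e; lra.
Qed.

Lemma form_CauchySchwarz f g : D f -> D g ->
  ip (A f) g ^+ 2 <= ip (A f) f * ip (A g) g.
Proof.
move=> Df Dg; apply: discriminant_le; first exact: dom_form_ge0.
move=> t; have : 0 <= ip (A (g + t *: f)) (g + t *: f) by apply: dom_form_ge0; auto.
by ipx; rewrite (ipC (A g) f) -(dom_symmetric Df Dg); lra.
Qed.

(** * Resolvent bounds and spectral gaps *)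

Variable N : E -> R.
Hypothesis NE : forall f, H f -> N f = Num.sqrt (ip f f).

Let res := resolvent_set H N D A.

Lemma resolvent_bound l : res l -> exists2 K : R, 0 <= K &
  forall f, D f -> ip f f <= K * ip (A f - l *: f) (A f - l *: f).
Proof.
move=> [_ [K hK]]; exists (K ^+ 2); first exact: sqr_ge0.
move=> f Df; have := hK f Df; rewrite !NE; [|by auto..].
move=> h; rewrite -(sqr_sqrtr (ip_ge0 (DH Df))).
have Hg : H (A f - l *: f) by auto.
rewrite -(sqr_sqrtr (ip_ge0 Hg)) -exprMn.
by rewrite ler_sqr ?nnegrE ?sqrtr_ge0// (le_trans _ h)// sqrtr_ge0.
Qed.

Lemma resolvent_surj l g : res l -> H g -> exists2 f, D f & A f - l *: f = g.
Proof. by move=> [h _] /h[f [[Df Af] _]]; exists f. Qed.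

(** Existence comes from the minimisation with [s = - l]. The bound holds because the cross term
    [- 2 l <A f, f>] is nonnegative. *)
Lemma resolvent_neg l : l < 0 -> res l.
Proof.
move=> l0; have s0 : 0 < - l by rewrite oppr_gt0.
split.
  move=> g Hg; have [u [f [_ Df Af _ _]]] := resolvent_approx s0 Hg.
  exists f; split=> [|h [Dh Ah]]; first by rewrite -scaleNr.
  apply: (resolvent_unique (ltW s0)) => //.
  by rewrite Af -Ah scaleNr.
exists (- l)^-1 => f Df; rewrite !NE; [|by auto..].
rewrite mulrC ler_pdivlMr// -[X in _ * X](ger0_norm (ltW s0)) -sqrtr_sqr mulrC.
rewrite -sqrtrM ?sqr_ge0// ler_wsqrtr//.
have h1 := dom_form_ge0 Df.
have h2 : 0 <= ip (A f) (A f) by apply: ip_ge0; auto.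
have h3 : 0 <= - l * ip (A f) f by rewrite mulr_ge0// ltW.
ipx; rewrite (ipC f (A f)); lra.
Qed.

(** If [A v = f] with [v] controlled by [f], Cauchy-Schwarz for the form gives
    [<f, f>^2 <= <f, v> <A f, f>], so the Rayleigh quotient of [f] is bounded below. *)
Lemma resolvent_not0 :
  (forall e, 0 < e -> exists2 f, C f & ip (A f) f < e * ip f f) ->
  ~ res 0.
Proof.
move=> small res0; have [K K0 hK] := resolvent_bound res0.
(* [K + 1] is positive and dominates the square root of [K], the bound for the norm of the
   inverse. *)
have e0 : 0 < (K + 1)^-1 by rewrite invr_gt0; lra.
have [f Cf hf] := small _ e0.
have [v Dv] := resolvent_surj res0 (CH Cf); rewrite scale0r subr0 => Av.
have := hK v Dv; rewrite scale0r subr0 Av => h1.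
have h2 := form_CauchySchwarz Dv (CD Cf); rewrite Av in h2.
have h3 := ip_CauchySchwarz (CH Cf) (DH Dv).
have h4 := A_form_ge0 Cf; have h5 := ip_ge0 (CH Cf).
have h6 := dom_form_ge0 Dv; rewrite Av in h6.
rewrite mulrC ltr_pdivlMr in hf; last lra.
move: h1 h2 h3 h4 h5 h6 hf.
move: (ip f f) (ip v v) (ip f v) (ip (A f) f) => y z x a h1 h2 h3 h4 h5 h6 hf.
have hx : x <= (K + 1) * y.
  rewrite -ler_sqr ?nnegrE//; last by rewrite mulr_ge0//; lra.
  have : y * z <= y * (K * y) by rewrite ler_wpM2l.
  have : 0 <= y ^+ 2 by exact: sqr_ge0.
  have : 0 <= K * y ^+ 2 by rewrite mulr_ge0// sqr_ge0.
  have : 0 <= K * (K * y ^+ 2) by rewrite !mulr_ge0// sqr_ge0.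
  nra.
have y0 : 0 < y by nra.
have : x * a <= (K + 1) * y * a by rewrite ler_wpM2r.
have : y * (a * (K + 1)) < y * y by rewrite ltr_pM2l.
lra.
Qed.

(* The point is that [norm (A - l)^-1 = 1 / dist (l, spectrum)] for
   [l = e / 2]: an almost maximising vector of [(A - l)^-1] violates the
   bounds of the resolvents at [l - d] and [l + d], [d] being the inverse of
   the norm. *)
Lemma spectral_gap e : (forall l, 0 < l -> l < e -> res l) ->
  forall f, D f -> e * ip (A f) f <= ip (A f) (A f).
Proof.
move=> gap f Df.
have [e0|e0] := leP e 0.
  apply: (@le_trans _ _ 0); last by apply: ip_ge0; auto.
  by rewrite mulr_le0_ge0// dom_form_ge0.
pose l := e / 2; have l0 : 0 < l by rewrite /l; lra.
pose B h := A h - l *: h.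
have HB h : D h -> H (B h) by rewrite /B; auto.
have resl : res l by apply: gap => //; rewrite /l; lra.
have [K K0 hK] := resolvent_bound resl.
(* Since [2 * l = e], expanding [B f] turns this into the claim. *)
suff : l ^+ 2 * ip f f <= ip (B f) (B f).
  rewrite /B; ipx; rewrite (ipC f (A f)) /l; lra.
have [-> |f0] := eqVneq f 0.
  by rewrite ip0r// mulr0 ip_ge0//; auto.
have ff0 : 0 < ip f f.
  rewrite lt_neqAle ip_ge0//; last by auto.
  rewrite andbT eq_sym; apply/eqP => h; move/eqP: f0; apply; apply: ip_eq0 => //.
  by auto.
(* The supremum of [S] is the inverse square of the norm of [(A - l)^-1]. *)
pose S := [set m | forall h, D h -> m * ip h h <= ip (B h) (B h)].
have SK : S (K + 1)^-1.
  move=> h Dh; rewrite mulrC ler_pdivrMr; last lra.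
  apply: (le_trans (hK h Dh)); rewrite -/(B h) mulrC ler_wpM2l//; last lra.
  by apply: ip_ge0; auto.
have Sub : ubound S (ip (B f) (B f) / ip f f).
  by move=> m /(_ f Df) h; rewrite ler_pdivlMr.
have supS : has_sup S by split; [exists (K + 1)^-1|exists (ip (B f) (B f) / ip f f)].
pose m := sup S.
have m0 : 0 < m.
  apply: lt_le_trans (ub_le_sup _ SK); last by case: supS.
  by rewrite invr_gt0; lra.
have Sm h : D h -> m * ip h h <= ip (B h) (B h).
  move=> Dh; have : 0 <= ip h h by apply: ip_ge0; auto.
  rewrite [0 <= _]le_eqVlt => /orP[/eqP<-|h0].
    by rewrite mulr0; apply: ip_ge0; auto.
  rewrite -ler_pdivlMr//; apply: ge_sup; first by case: supS.
  by move=> k /(_ h Dh); rewrite ler_pdivlMr.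
rewrite leNgt; apply/negP => lt_l.
(* Hence [d < l], and both [l - d] and [l + d] lie in the gap []0, e[]. *)
have ml : m < l ^+ 2.
  rewrite -(ltr_pM2r ff0); exact: le_lt_trans (Sm f Df) lt_l.
pose d := Num.sqrt m.
have d0 : 0 < d by rewrite sqrtr_gt0.
have dm : d ^+ 2 = m by rewrite sqr_sqrtr// ltW.
have dl : d < l by rewrite -ltr_sqr ?nnegrE ?ltW// dm.
have [|K1 K10 hK1] := @resolvent_bound (l - d).
- by apply: gap; rewrite /l in dl *; lra.
have [|K2 K20 hK2] := @resolvent_bound (l + d).
- by apply: gap; rewrite /l in dl *; lra.
(* [eta] is chosen so that [K1 * K2 * eta * (m + 1) = K1 * K2 / M < 1], which contradicts [b6]
   combined with [b7]. *)
pose M := K1 * K2 + 1; have M0 : 1 <= M by rewrite /M lerDr mulr_ge0.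
pose eta := (M * (m + 1))^-1.
have M10 : 1 <= M * (m + 1) by nra.
have eta0 : 0 < eta by rewrite invr_gt0; lra.
have eta1 : eta <= 1 by rewrite /eta invf_le1//; lra.
have [h Dh hh] : exists2 h, D h & ip (B h) (B h) < (m + eta) * ip h h.
  apply: contrapT => nh.
  have : S (m + eta).
    by move=> h Dh; rewrite leNgt; apply/negP => hh; apply: nh; exists h.
  move=> /(ub_le_sup (proj2 supS)); rewrite -/m; lra.
have [g Dg Bg] := resolvent_surj resl (DH Dh).
have y0 : 0 < ip h h.
  have b0 : 0 <= ip (B h) (B h) by apply: ip_ge0; auto.
  have me : 0 < m + eta by lra.
  by rewrite -(pmulr_rgt0 _ me); exact: le_lt_trans b0 hh.
have gB : ip g (B h) = ip h h.
  have -> : ip h h = ip (B g) h by rewrite /B Bg.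
  by rewrite /B; ipx; rewrite (dom_symmetric Dg Dh); ring.
have mg := Sm g Dg; rewrite /B Bg in mg.
(* [k = (B - d) (B + d) g] with [B g = h]. It is small as [h] almost attains the infimum [m], so the
   two resolvent bounds make [g] small, against [<g, B h> = <h, h>]. *)
pose k := B h - m *: g.
have kE : A (h + d *: g) - (l + d) *: (h + d *: g) = k.
  rewrite /k /B AD AZ -dm; have -> : A g = h + l *: g by rewrite -Bg subrK.
  rewrite !scalerDr !scalerA -!addrA; congr (_ + _).
  rewrite opprD [X in _ + X]addrCA addrA -!scalerBl -(scaleNr l h) -(scaleNr (d ^+ 2) g).
    by congr (_ *: _ + _ *: _); ring.
have Hk : H k by rewrite /k; auto.
have kk : ip k k <= eta * ip h h.
  have Hm : H (m *: g) by auto.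
  have : ip k k = ip (B h) (B h) - 2 * m * ip h h + m * (m * ip g g).
    have := HB h Dh; have := gB; rewrite /k; move: (B h) => b gb Hb.
    ipx. rewrite (ipC b g) gb; ring.
  have : m * (m * ip g g) <= m * ip h h.
    by apply: ler_wpM2l; [exact: ltW|].
  lra.
have Dhg : D (h + d *: g) by auto.
have hg : A g - (l - d) *: g = h + d *: g.
  by rewrite -[in RHS]Bg /B scalerBl opprB addrA addrAC.
have b1 := hK1 g Dg; rewrite hg in b1.
have b2 := hK2 _ Dhg; rewrite kE in b2.
have b3 := ip_CauchySchwarz (DH Dg) (HB h Dh); rewrite gB in b3.
have b4 : ip g g <= K1 * (K2 * (eta * ip h h)).
  apply: (le_trans b1); rewrite ler_wpM2l//; apply: (le_trans b2).
  by rewrite ler_wpM2l.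
have b5 : ip h h ^+ 2 <= (K1 * (K2 * (eta * ip h h))) * ((m + eta) * ip h h).
  apply: (le_trans b3); apply: ler_pM => //.
  - by apply: ip_ge0; auto.
  - by apply: ip_ge0; auto.
  - exact: ltW.
have b6 : 1 <= K1 * K2 * eta * (m + eta).
  rewrite -(ler_pM2r (exprn_gt0 2 y0)) mul1r; apply: (le_trans b5).
  by rewrite le_eqVlt; apply/orP; left; apply/eqP; ring.
have b7 : K1 * K2 * eta * (m + eta) <= K1 * K2 * eta * (m + 1).
  by rewrite ler_wpM2l ?lerD// !mulr_ge0// ltW.
have : M * (m + 1) <= K1 * K2 * (m + 1).
  have := le_trans b6 b7.
  by rewrite mulrAC /eta ler_pdivlMr ?mul1r//; lra.
rewrite /M; lra.
Qed.

(* [x^2 (x - e) = x (x - e)^2 + e x (x - e)], and both summands are nonnegative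
   when evaluated at [A]. *)
Lemma gap_form_range e f :
  (forall l, 0 < l -> l < e -> res l) -> D f -> D (A f) ->
  e * ip (A f) (A f) <= ip (A (A f)) (A f).
Proof.
move=> gap Df DAf; have [e0|e0] := ltP e 0.
  apply: (@le_trans _ _ 0); last by apply: dom_form_ge0; auto.
  by apply: mulr_le0_ge0; [exact: ltW|apply: ip_ge0; auto].
have : 0 <= ip (A (A f - e *: f)) (A f - e *: f) by apply: dom_form_ge0; auto.
have := spectral_gap gap Df => h1.
have : e * (e * ip (A f) f) <= e * ip (A f) (A f) by rewrite ler_wpM2l.
ipx; rewrite (dom_symmetric DAf Df); lra.
Qed.

(* The vectors [w n = f - r n (A + r n)^-1 f] lie in the range of [A], and they
   converge to [f] because [A] is injective. *)
Lemma gap_form e f : (forall l, 0 < l -> l < e -> res l) -> 0 < e -> C f ->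
  e * ip f f <= ip (A f) f.
Proof.
move=> gap e0 Cf.
have Hf : H f by auto.
pose r n : R := n.+1%:R^-1.
have r0 n : 0 < r n by rewrite invr_gt0.
have r1 n : r n <= 1 by rewrite invf_le1// ler1n.
have /choice[v hv] : forall n, exists v, D v /\ A v + r n *: v = f.
  by move=> n; have [_ [v [_ Dv Av _ _]]] := resolvent_approx (r0 n) Hf; exists v.
have Dv n : D (v n) by case: (hv n).
pose p n := r n *: v n; pose w n := A (v n).
have wp n : w n = f - p n by rewrite -(proj2 (hv n)) addrK.
have Dp n : D (p n) by rewrite /p; auto.
have Dw n : D (w n) by rewrite wp; auto.
have Hp n : H (p n) by auto.
have Hw n : H (w n) by auto.
(* In the expansion of [f = w n + r n v n] the cross term is nonnegative. *)
have ww n : ip (w n) (w n) <= ip f f.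
  have h1 : 0 <= ip (w n) (v n) := dom_form_ge0 (Dv n).
  have -> : ip f f = ip (w n + r n *: v n) (w n + r n *: v n).
    by rewrite (proj2 (hv n)).
  have Hv : H (v n) by auto.
  have h3 : 0 <= r n * (r n * ip (v n) (v n)).
    by rewrite !mulr_ge0 ?ip_ge0 ?ltW.
  move: (w n) (v n) (r n) (r0 n) (Hw n) Hv h1 h3 => a b t t0 Ha Hb h1 h3.
  have : 0 <= t * ip a b by rewrite mulr_ge0// ltW.
  by ipx; rewrite (ipC b a); lra.
(* The difference [d] lies in the range of [A], so [e <d, d> <= <A d, d>], while
   [A d = r n w n - r m w m] is small because the [w n] are bounded. *)
have [q Hq pq] : exists2 q, H q & cv p q.
  apply: (@ip_cauchy_cvg _ (2 * ip f f / e ^+ 2)) => // n m.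
  pose d := p n - p m; rewrite -/d.
  have dA : d = A (v m - v n).
    by rewrite AD AN -/(w m) -/(w n) !wp /d opprB [RHS]addrC addrA subrK.
  have Dvv : D (v m - v n) by auto.
  have Dd : D d by rewrite /d; auto.
  have Ad : A d = r n *: w n - r m *: w m by rewrite /d AD AN !AZ.
  have h1 : e * ip d d <= ip (A d) d.
    by have := gap_form_range gap Dvv; rewrite -dA => /(_ Dd).
  have h2 := ip_CauchySchwarz (AH Dd) (DH Dd).
  have h3 : ip (A d) (A d) <= 2 * ip f f * (r n + r m).
    have : 0 <= ip (r n *: w n + r m *: w m) (r n *: w n + r m *: w m).
      by apply: ip_ge0; auto.
    rewrite Ad; ipx.
    have h4 k : r k * (r k * ip (w k) (w k)) <= ip f f * r k.
      rewrite [leRHS]mulrC ler_wpM2l ?(ltW (r0 k))//.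
      apply: le_trans (ww k); rewrite ler_piMl//; apply: ip_ge0; auto.
    have := h4 n; have := h4 m; lra.
  have h5 : 0 <= ip d d by apply: ip_ge0; auto.
  have h6 : 0 <= ip (A d) (A d) by apply: ip_ge0; auto.
  rewrite mulrAC ler_pdivlMr ?exprn_gt0//; apply: le_trans h3.
  move: h5; rewrite [0 <= _]le_eqVlt => /orP[/eqP<-|h5]; first by rewrite mul0r.
  rewrite -(ler_pM2r h5); apply: le_trans h2.
  have -> : ip d d * e ^+ 2 * ip d d = (e * ip d d) ^+ 2 by ring.
  rewrite ler_sqr ?nnegrE ?(le_trans _ h1)//; apply: mulr_ge0; exact: ltW.
(* [<p n, A h> = r n <w n, h>] tends to 0, so the limit [q] is in the kernel of [A]. *)
have q0 : q = 0.
  have [Dq Aq] : D q /\ A q = 0.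
    apply: A_adj_dom => // h Ch; rewrite ip0l//; last by auto.
    have l1 : ip (p n) (A h) @[n --> \oo] --> ip q (A h).
      by apply: ip_cvg => //; auto using cv_cst.
    apply: (cvg_unique (@Rhausdorff R) l1).
    apply: (@sqr_le_cvg0 _ _ (fun n => (ip f f * ip h h) * r n)).
      by rewrite -[X in _ --> X](mulr0 (ip f f * ip h h)); apply: cvgMr; exact: cvg_harmonic.
    move=> n; rewrite -(A_adj (Dp n) Ch) /p AZ -/(w n) ipZl//; last by auto.
    rewrite exprMn mulrC.
    apply: ler_pM; rewrite ?sqr_ge0//; last first.
      by rewrite expr2 ler_piMl// ltW.
    apply: (le_trans (ip_CauchySchwarz (Hw n) (CH Ch))).
    by rewrite ler_wpM2r// ip_ge0//; auto.
  by apply: (@A_inj 0) => //; rewrite Aq scale0r addr0.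
rewrite q0 in pq.
have wf : cv w f.
  rewrite /cv; apply: cvg_trans pq; apply: near_eq_cvg; apply: nearW => n.
  by rewrite wp addrAC subrr add0r subr0 ipNl// ?ipNr// ?opprK; auto.
have l1 : e * ip (w n) (w n) @[n --> \oo] --> e * ip f f.
  by apply: cvgMr; apply: ip_cvg.
have l2 : ip (A f) (w n) @[n --> \oo] --> ip (A f) f.
  by apply: ip_cvg => //; auto using cv_cst.
apply: (ler_cvg_to l1 l2); apply: nearW => n.
(* [A (w n) = A f - r n w n], hence [<A (w n), w n> <= <A f, w n>], which has a limit since [A f] is
   fixed. *)
apply: (le_trans (gap_form_range gap (Dv n) (Dw n))).
rewrite -/(w n) {1}wp /p AD AN AZ -/(w n) ipDl ?ipNl ?ipZl; [|by auto..].
by rewrite gerBl// mulr_ge0 ?ip_ge0// ltW.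
Qed.

Theorem ess_spectrum_bottom_eq0 :
  (forall e, 0 < e -> exists2 f, C f & ip (A f) f < e * ip f f) ->
  ess_spectrum_bottom H N D A = 0%E.
Proof.
move=> small.
have sp0 := resolvent_not0 small.
apply/eqP; rewrite eq_le; apply/andP; split.
  apply: ereal_inf_lbound; exists 0 => //; split => //; left.
  move=> U /nbhs_ballP[e /= e0 eU].
  have [l l0 [le nl]] : exists2 l, 0 < l & l < e /\ ~ res l.
    apply: contrapT => nl.
    have gap l : 0 < l -> l < e -> res l.
      by move=> l0 le; apply: contrapT => h; apply: nl; exists l.
    have [f Cf] := small e e0.
    by rewrite ltNge (gap_form gap e0 Cf).
  exists l; split => //; first by rewrite gt_eqF.
  by apply: eU; rewrite /ball/= sub0r normrN gtr0_norm.
apply: le_ereal_inf_tmp => _ [l [spl _] <-]; rewrite lee_fin leNgt; apply/negP.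
by move=> /resolvent_neg.
Qed.

End SpectrumBottom.

(** * The weighted l2 space *)

Section WeightedL2.
Context {R : realType} {V : countType}.
Variables (theta : V -> R) (e : nat -> V) (idx : V -> nat).
Hypothesis theta_gt0 : forall x, 0 < theta x.
Hypothesis eK : cancel e idx.
Hypothesis idxK : cancel idx e.

Definition l2_term (f g : V -> R) : nat -> R :=
  fun i => f (e i) * g (e i) * theta (e i).

(** The terms have both signs, so a real series along the enumeration [e] replaces the extended sum;
    it converges absolutely on [l2]. *)
Definition l2_ip (f g : V -> R) : R := limn (series (l2_term f g)).

Lemma l2_term_ge0 f i : 0 <= l2_term f f i.
Proof. by rewrite mulr_ge0 ?(ltW (theta_gt0 _))// -expr2 sqr_ge0. Qed.

Lemma l2_sqnormE f :
  l2_sqnorm theta f = (\big[+%E/0%R]_(0 <= i <oo) (l2_term f f i)%:E)%E.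
Proof.
rewrite nneseries_esumT; last by move=> n; rewrite lee_fin l2_term_ge0.
rewrite /l2_sqnorm (reindex_esum [set: nat] [set: V] e).
  by apply: eq_esum => i _; rewrite /l2_term expr2.
by rewrite setTT_bijective; exists idx.
Qed.

Lemma l2P f : l2 theta f <-> cvgn (series (l2_term f f)).
Proof.
rewrite /l2/= l2_sqnormE; split => [|cf].
  by apply: nnseries_is_cvg => i; exact: l2_term_ge0.
have -> : (\big[+%E/0%R]_(0 <= i <oo) (l2_term f f i)%:E)%E =
    limn (EFin \o series (l2_term f f)).
  by congr (limn _); apply/funext => n /=; rewrite /series/= sumEFin.
by rewrite EFin_lim// ltry.
Qed.

Lemma l2_normE f : l2 theta f -> l2_norm theta f = Num.sqrt (l2_ip f f).
Proof.
move=> /l2P cf; rewrite /l2_norm l2_sqnormE.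
have -> : (\big[+%E/0%R]_(0 <= i <oo) (l2_term f f i)%:E)%E =
    limn (EFin \o series (l2_term f f)).
  by congr (limn _); apply/funext => n /=; rewrite /series/= sumEFin.
by rewrite EFin_lim.
Qed.

Lemma l2_partial_le f n : l2 theta f -> series (l2_term f f) n <= l2_ip f f.
Proof.
move=> /l2P cf; apply: nondecreasing_cvgn_le => //.
by apply: nondecreasing_series => i _ _; exact: l2_term_ge0.
Qed.

Lemma l2_bounded f (M : R) :
  (forall n, series (l2_term f f) n <= M) -> l2 theta f /\ l2_ip f f <= M.
Proof.
move=> fM.
have cf : cvgn (series (l2_term f f)).
  apply: nondecreasing_is_cvgn.
    by apply: nondecreasing_series => i _ _; exact: l2_term_ge0.
  by exists M => _ [n _ <-].
split; first exact/l2P.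
by apply: limr_le => //; apply: nearW => n.
Qed.

Lemma l2_lin a f g : l2 theta f -> l2 theta g -> l2 theta (a *: f + g).
Proof.
move=> /l2P cf /l2P cg; apply/l2P.
(* Domination by [(a x + y)^2 <= 2 a^2 x^2 + 2 y^2]. *)
apply: (@series_le_cvg _ _ ((2 * a ^+ 2) *: l2_term f f + 2 *: l2_term g g)).
- exact: l2_term_ge0.
- move=> i; apply: addr_ge0; apply: mulr_ge0; rewrite ?l2_term_ge0//.
  by rewrite mulr_ge0// sqr_ge0.
- move=> i; rewrite /l2_term.
  change ((a * f (e i) + g (e i)) * (a * f (e i) + g (e i)) * theta (e i) <=
    2 * a ^+ 2 * (f (e i) * f (e i) * theta (e i)) +
    2 * (g (e i) * g (e i) * theta (e i))).
  have : 0 <= (a * f (e i) - g (e i)) ^+ 2 * theta (e i).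
    by rewrite mulr_ge0 ?sqr_ge0// ltW.
  lra.
- by apply: is_cvg_seriesD; exact: is_cvg_seriesZ.
Qed.

Lemma l2_ip_cvg f g : l2 theta f -> l2 theta g -> cvgn (series (l2_term f g)).
Proof.
move=> /l2P cf /l2P cg; apply: normed_cvg.
apply: (@series_le_cvg _ _ (l2_term f f + l2_term g g)).
- by move=> i; exact: normr_ge0.
- by move=> i; apply: addr_ge0; exact: l2_term_ge0.
- move=> i.
  change (`|f (e i) * g (e i) * theta (e i)| <=
    f (e i) * f (e i) * theta (e i) + g (e i) * g (e i) * theta (e i)).
  have t0 := ltW (theta_gt0 (e i)).
  rewrite normrM (ger0_norm t0) -mulrDl ler_wpM2r//.
  have := sqr_ge0 (f (e i) + g (e i)); have := sqr_ge0 (f (e i) - g (e i)).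
  by rewrite ler_norml => h1 h2; apply/andP; split; nra.
- exact: is_cvg_seriesD.
Qed.

Lemma l2_ipC f g : l2_ip f g = l2_ip g f.
Proof.
by rewrite /l2_ip; congr (limn (series _)); apply/funext => i;
  rewrite /l2_term (mulrC (f _)).
Qed.

Lemma l2_ip_lin a f g h : l2 theta f -> l2 theta g -> l2 theta h ->
  l2_ip (a *: f + g) h = a * l2_ip f h + l2_ip g h.
Proof.
move=> lf lg lh; have cf := l2_ip_cvg lf lh; have cg := l2_ip_cvg lg lh.
rewrite /l2_ip -[a * _]/(a *: _) -lim_seriesZ// -lim_seriesD//.
  congr (limn (series _)); apply/funext => i.
  change ((a * f (e i) + g (e i)) * h (e i) * theta (e i) =
    a * (f (e i) * h (e i) * theta (e i)) + g (e i) * h (e i) * theta (e i)).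
  ring.
exact: is_cvg_seriesZ.
Qed.

Lemma l2_ip_ge0 f : l2 theta f -> 0 <= l2_ip f f.
Proof. by move=> /(l2_partial_le 0); rewrite /series/= big_geq. Qed.

Lemma l2_coord_le f x : l2 theta f -> f x ^+ 2 * theta x <= l2_ip f f.
Proof.
move=> lf; apply: le_trans (l2_partial_le (idx x).+1 lf).
rewrite /series/= big_nat_recr//= /l2_term idxK -expr2 lerDr.
by apply: sumr_ge0 => i _; exact: l2_term_ge0.
Qed.

Lemma l2_ip_eq0 f : l2 theta f -> l2_ip f f = 0 -> f = 0.
Proof.
move=> lf f0; apply/funext => x; apply/eqP; rewrite -sqrf_eq0 eq_le sqr_ge0 andbT.
by have := l2_coord_le x lf; rewrite f0 pmulr_lle0.
Qed.

(** The limit is taken pointwise, as the norm controls each coordinate. Finite partial sums of the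
    squared norm pass to the limit in [m], which bounds [u n - f]. *)
Lemma l2_complete (u : nat -> V -> R) : (forall n, l2 theta (u n)) ->
  (forall r, 0 < r -> exists N, forall n m, (N <= n)%N -> (N <= m)%N ->
    l2_ip (u n - u m) (u n - u m) <= r) ->
  exists2 f, l2 theta f & l2_ip (u n - f) (u n - f) @[n --> \oo] --> 0.
Proof.
move=> lu cu.
have lB n m : l2 theta (u n - u m).
  by rewrite addrC -scaleN1r; exact: l2_lin.
have cx x : cvgn (fun n => u n x).
  apply: R_complete; apply: cauchy_exP => r /= r0.
  have /cu[N hN] : 0 < (r / 2) ^+ 2 * theta x by rewrite mulr_gt0// exprn_gt0// divr_gt0.
  exists (u N x); exists N => // n /= Nn; rewrite /ball/=.
  have := le_trans (l2_coord_le x (lB N n)) (hN _ _ (leqnn N) Nn).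
  rewrite ler_pM2r//.
  change ((u N x - u n x) ^+ 2 <= (r / 2) ^+ 2 -> `|u N x - u n x| < r).
  rewrite -(real_normK (num_real _)) ler_sqr ?nnegrE//; last by rewrite ltW// divr_gt0.
  by move=> h; apply: (le_lt_trans h); lra.
pose f x := limn (fun n => u n x).
have tail r N : (forall n m, (N <= n)%N -> (N <= m)%N ->
    l2_ip (u n - u m) (u n - u m) <= r) -> forall n, (N <= n)%N ->
    l2 theta (u n - f) /\ l2_ip (u n - f) (u n - f) <= r.
  move=> hN n Nn; apply: l2_bounded => k.
  have : series (l2_term (u n - u m) (u n - u m)) k @[m --> \oo] -->
      series (l2_term (u n - f) (u n - f)) k.
    rewrite /series/=; elim: k => [|k IH].
      by under eq_fun do rewrite big_geq//; rewrite big_geq//; exact: cvg_cst.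
    under eq_fun do rewrite big_nat_recr//=.
    rewrite big_nat_recr//=; apply: cvgD => //; rewrite /l2_term.
    have h : (u n - u m) (e k) @[m --> \oo] --> (u n - f) (e k).
      change (u n (e k) - u m (e k) @[m --> \oo] --> u n (e k) - f (e k)).
      by apply: cvgB; [exact: cvg_cst|exact: cx].
    by apply: cvgMl; exact: cvgM.
  move=> /cvgr_to_le; apply; exists N => // m /= Nm.
  exact: le_trans (l2_partial_le _ (lB n m)) (hN _ _ Nn Nm).
exists f.
  have [N hN] := cu 1 ltr01; have [lf _] := tail _ _ hN N (leqnn N).
  have -> : f = -1 *: (u N - f) + u N by rewrite scaleN1r opprB subrK.
  exact: l2_lin.
apply/cvgrPdist_le => r r0; have [N hN] := cu r r0.
exists N => // n /= Nn; have [lf le] := tail _ _ hN n Nn.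
by rewrite sub0r normrN ger0_norm// l2_ip_ge0.
Qed.

(* [e] enumerates [V], so these are the finitely supported functions. *)
Definition fin_supp : set (V -> R) :=
  [set f | exists n, forall i, (n <= i)%N -> f (e i) = 0].

Lemma fin_supp_lin a f g : fin_supp f -> fin_supp g -> fin_supp (a *: f + g).
Proof.
move=> [n hn] [m hm]; exists (maxn n m) => i; rewrite geq_max => /andP[ni mi].
by change (a * f (e i) + g (e i) = 0); rewrite hn// hm// mulr0 addr0.
Qed.

Lemma l2_ip_fin n f g : (forall i, (n <= i)%N -> f (e i) * g (e i) = 0) ->
  l2_ip f g = \sum_(i < n) f (e i) * g (e i) * theta (e i).
Proof.
move=> h; rewrite /l2_ip; apply: (lim_near_cst (@Rhausdorff R)).
exists n => // m /= nm; rewrite /series/= (big_cat_nat (leq0n n) nm)//=.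
rewrite big_mkord [X in _ + X](_ : _ = 0) ?addr0//.
rewrite big_nat_cond big1// => i /andP[/andP[ni _] _].
by rewrite /l2_term h// mul0r.
Qed.

Lemma fin_supp_l2 f : fin_supp f -> l2 theta f.
Proof.
move=> [n hn]; apply/l2P; apply: (cvgP (series (l2_term f f) n)).
apply: cvg_near_cst; exists n => // m /= nm; rewrite /series/= (big_cat_nat (leq0n n) nm)//=.
rewrite [X in _ + X](_ : _ = 0) ?addr0//.
rewrite big_nat_cond big1// => i /andP[/andP[ni _] _].
by rewrite /l2_term hn// !mul0r.
Qed.

Lemma fin_supp_delta x : fin_supp (fun y => (y == x)%:R).
Proof.
exists (idx x).+1 => i; case: eqP => // <-; by rewrite eK ltnn.
Qed.

Lemma l2_ip_delta f x : l2_ip f (fun y => (y == x)%:R) = f x * theta x.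
Proof.
rewrite (@l2_ip_fin (idx x).+1); last first.
  by move=> i; case: eqP => [<-|]; rewrite ?eK ?ltnn ?mulr0.
rewrite big_ord_recr/= idxK eqxx mulr1 big1 ?add0r// => i _.
rewrite (_ : (e i == x) = false) ?mulr0 ?mul0r//.
by apply/eqP => h; have := ltn_ord i; rewrite -[X in (_ < idx X)%N]h eK ltnn.
Qed.

End WeightedL2.

(** * The graph Laplacian *)

Section GraphLaplacian.
Context {R : realType} {V : countType}.
Variables (G : weighted_graph R V).
Variables (theta : V -> R) (e : nat -> V) (idx : V -> nat).
Hypothesis theta_gt0 : forall x, 0 < theta x.
Hypothesis eK : cancel e idx.
Hypothesis idxK : cancel idx e.

Local Notation L := (laplacian G theta).
Local Notation ip := (l2_ip theta e).

Lemma weight_eq0 x y : ~~ adj G x y -> weight G x y = 0.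
Proof.
move=> nxy; apply/eqP; rewrite eq_le weight_ge0 andbT leNgt.
by apply/negP => /weight_gt0; apply/negP.
Qed.

Lemma fsbig_adjE x (F : V -> R) N :
  (forall y, adj G x y -> F y != 0 -> (idx y < N)%N) ->
  \sum_(y \in [set y | adj G x y]) weight G x y * F y =
  \sum_(j < N) weight G x (e j) * F (e j).
Proof.
move=> FN; rewrite (fsbig_ord _ N (fun j => weight G x (e j) * F (e j))).
rewrite (@fsbig_widen _ _ _ _ [set y | adj G x y] setT)//; last first.
  by move=> y [_ /= /negP nxy]; rewrite /preimage/= weight_eq0// mul0r.
rewrite (reindex_fsbig e [set: nat] setT); last first.
  by rewrite setTT_bijective; exists idx.
apply/esym/fsbig_widen => // j [_ /= /negP jN].
have [xj|nxj] := boolP (adj G x (e j)); last by rewrite weight_eq0// mul0r.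
have [->|Fj] := eqVneq (F (e j)) 0; first by rewrite mulr0.
have jN' : (j < N)%N by rewrite -[j]eK; exact: FN.
by move: jN; rewrite jN'.
Qed.

(** Only neighbours where [f] differs from [f x] restrict [N], so [N = 0] is admissible where [f] is
    locally constant. *)
Lemma laplacianE f x N :
  (forall y, adj G x y -> f y != f x -> (idx y < N)%N) ->
  L f x * theta x = \sum_(j < N) weight G x (e j) * (f (e j) - f x).
Proof.
move=> fN; rewrite /laplacian mulrAC mulVf ?gt_eqF// mul1r.
by apply: (@fsbig_adjE x (fun y => f y - f x)) => y xy; rewrite subr_eq0; exact: fN.
Qed.

Lemma adj_bound x : exists N, forall y, adj G x y -> (idx y < N)%N.
Proof.
have /finite_seqP[s sE] := wg_locally_finite G x.
exists (\max_(y <- s) idx y).+1 => y xy; rewrite ltnS.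
apply: (@leq_bigmax_seq _ _ xpredT idx) => //.
by have : [set y | adj G x y] y by []; rewrite sE.
Qed.

Lemma adj_bound_below n :
  exists N, forall i, (i < n)%N -> forall y, adj G (e i) y -> (idx y < N)%N.
Proof.
elim: n => [|n [N hN]]; first by exists 0%N.
have [M hM] := adj_bound (e n); exists (maxn N M) => i; rewrite ltnS leq_eqVlt.
move=> /predU1P[->|im] y yi; rewrite leq_max.
  by rewrite (hM _ yi) orbT.
by rewrite (hN _ im _ yi).
Qed.

Lemma laplacian_lin a f g : L (a *: f + g) = a *: L f + L g.
Proof.
apply/funext => x; have [N hN] := adj_bound x.
apply: (mulIf (x := theta x)); first by rewrite gt_eqF.
change (L (a *: f + g) x * theta x = (a * L f x + L g x) * theta x).
rewrite mulrDl -mulrA !(@laplacianE _ x N); try by move=> y /hN.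
rewrite big_distrr/= -big_split/=; apply: eq_bigr => j _.
change (weight G x (e j) * (a * f (e j) + g (e j) - (a * f x + g x)) =
  a * (weight G x (e j) * (f (e j) - f x)) + weight G x (e j) * (g (e j) - g x)).
ring.
Qed.

(** One cutoff past the support and its neighbours. The last clause also serves for the Laplacian of
    an arbitrary function at points of the support of [f]. *)
Lemma fin_supp_bound f : fin_supp e f -> exists M,
  [/\ forall i, (M <= i)%N -> f (e i) = 0,
      forall i, (M <= i)%N -> L f (e i) = 0,
      forall i, (i < M)%N -> forall y, adj G (e i) y -> f y != f (e i) -> (idx y < M)%N &
      forall i, f (e i) != 0 -> forall y, adj G (e i) y -> (idx y < M)%N].
Proof.
move=> [n hn]; have [N hN] := adj_bound_below n.
have f0 y : f y != 0 -> (idx y < n)%N.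
  by apply: contraR; rewrite -leqNgt => /hn; rewrite idxK => ->.
have hN' i y : adj G (e i) y -> f y != f (e i) -> (idx y < maxn n N)%N.
  move=> iy; have [->|fi _] := eqVneq (f (e i)) 0.
    by move=> /f0 yn; rewrite leq_max yn.
  by rewrite leq_max (hN i _ y)// ?orbT//; have := f0 _ fi; rewrite eK.
exists (maxn n N); split.
- by move=> i; rewrite geq_max => /andP[ni _]; exact: hn.
- move=> i; rewrite geq_max => /andP[ni Ni].
  apply: (mulIf (x := theta (e i))); first by rewrite gt_eqF.
  rewrite mul0r (@laplacianE _ _ 0)//= ?big_ord0// => y iy.
  rewrite hn// => /f0 yn; have := hN _ yn; rewrite idxK => /(_ (e i)).
  by rewrite adj_sym => /(_ iy); rewrite eK ltnNge Ni.
- by move=> i _; exact: hN'.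
- move=> i /f0; rewrite eK => ni y iy; rewrite leq_max (hN i _ y)// orbT//.
Qed.

(** Green's formula: the finite support of [g] makes both sides finite double sums, matched by
    exchanging the indices and the symmetry of the weights. *)
Lemma laplacian_adjoint f g : fin_supp e g -> ip (- L f) g = ip f (- L g).
Proof.
move=> /fin_supp_bound[M [g0 Lg0 gM gM']].
rewrite (@l2_ip_fin _ _ _ _ M); last by move=> i /g0 ->; rewrite mulr0.
rewrite (@l2_ip_fin _ _ _ _ M); last first.
  by move=> i /Lg0 h; change (f (e i) * - L g (e i) = 0); rewrite h oppr0 mulr0.
transitivity (- \sum_(i < M) \sum_(j < M)
    weight G (e i) (e j) * (f (e j) - f (e i)) * g (e i)).
  rewrite -sumrN; apply: eq_bigr => i _.
  change (- L f (e i) * g (e i) * theta (e i) = - \sum_(j < M)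
    weight G (e i) (e j) * (f (e j) - f (e i)) * g (e i)).
  have [->|gi] := eqVneq (g (e i)) 0.
    by rewrite mulr0 mul0r big1 ?oppr0// => j _; rewrite mulr0.
  rewrite mulrAC mulNr (@laplacianE _ _ M) ?mulNr ?big_distrl//=.
  by move=> y iy _; exact: gM' iy.
transitivity (- \sum_(i < M) \sum_(j < M)
    f (e i) * (weight G (e i) (e j) * (g (e j) - g (e i)))); last first.
  rewrite -sumrN; apply: eq_bigr => i _.
  change (- \sum_(j < M) f (e i) * (weight G (e i) (e j) * (g (e j) - g (e i))) =
    f (e i) * - L g (e i) * theta (e i)).
  rewrite mulrN mulNr -mulrA (@laplacianE _ _ M) ?big_distrr//=.
  by move=> y iy gy; exact: gM iy gy.
congr (- _).
under eq_bigr do under eq_bigr do rewrite mulrBr mulrBl.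
under eq_bigr do rewrite sumrB.
rewrite sumrB.
under [RHS]eq_bigr do under eq_bigr do rewrite mulrBr mulrBr.
under [RHS]eq_bigr do rewrite sumrB.
rewrite sumrB exchange_big/=; congr (_ - _).
  apply: eq_bigr => i _; apply: eq_bigr => j _; rewrite weight_sym; ring.
by apply: eq_bigr => i _; apply: eq_bigr => j _; ring.
Qed.

Lemma laplacian_energy f : fin_supp e f -> exists N, forall M, (N <= M)%N ->
  ip (- L f) f = 2^-1 * \sum_(i < M) \sum_(j < M)
    weight G (e i) (e j) * (f (e j) - f (e i)) ^+ 2.
Proof.
move=> ff; have [N [f0 _ fN fN']] := fin_supp_bound ff; exists N => M NM.
have {}f0 i : (M <= i)%N -> f (e i) = 0 by move=> Mi; apply: f0; exact: leq_trans Mi.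
rewrite (@l2_ip_fin _ _ _ _ M); last by move=> i /f0 ->; rewrite mulr0.
have E : \sum_(i < M) (- L f) (e i) * f (e i) * theta (e i) =
    - \sum_(i < M) \sum_(j < M)
      weight G (e i) (e j) * (f (e j) - f (e i)) * f (e i).
  rewrite -sumrN; apply: eq_bigr => i _.
  change (- L f (e i) * f (e i) * theta (e i) = - \sum_(j < M)
    weight G (e i) (e j) * (f (e j) - f (e i)) * f (e i)).
  have [->|gi] := eqVneq (f (e i)) 0.
    by rewrite mulr0 mul0r big1 ?oppr0// => j _; rewrite mulr0.
  rewrite mulrAC mulNr (@laplacianE _ _ M) ?mulNr ?big_distrl//=.
  by move=> y iy _; apply: leq_trans NM; exact: fN' iy.
(* Exchanging [i] and [j] gives a second expression for the same sum; adding it to [E] produces the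
   squares. *)
have E' : \sum_(i < M) (- L f) (e i) * f (e i) * theta (e i) =
    \sum_(i < M) \sum_(j < M)
      weight G (e i) (e j) * (f (e j) - f (e i)) * f (e j).
  rewrite E exchange_big/= -sumrN; apply: eq_bigr => i _; rewrite -sumrN.
  by apply: eq_bigr => j _; rewrite weight_sym; ring.
have -> : \sum_(i < M) \sum_(j < M) weight G (e i) (e j) * (f (e j) - f (e i)) ^+ 2 =
  \sum_(i < M) \sum_(j < M) weight G (e i) (e j) * (f (e j) - f (e i)) * f (e j) -
  \sum_(i < M) \sum_(j < M) weight G (e i) (e j) * (f (e j) - f (e i)) * f (e i).
  rewrite -sumrB; apply: eq_bigr => i _; rewrite -sumrB.
  by apply: eq_bigr => j _; ring.
by rewrite -E' -E; field.
Qed.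

Lemma laplacian_form_ge0 f : fin_supp e f -> 0 <= ip (- L f) f.
Proof.
move=> /laplacian_energy[N /(_ _ (leqnn N)) ->]; rewrite mulr_ge0//.
by apply: sumr_ge0 => i _; apply: sumr_ge0 => j _; rewrite mulr_ge0 ?sqr_ge0// weight_ge0.
Qed.

(** Testing with the indicator of a vertex gives the equation pointwise, and then [L f] is in [l2]
    because [g] is. *)
Lemma laplacian_weak f g : l2 theta f -> l2 theta g ->
  (forall h, fin_supp e h -> ip f (- L h) = ip g h) ->
  laplacian_dom G theta f /\ - L f = g.
Proof.
move=> lf lg h.
suff E : - L f = g.
  split=> //; split=> //.
  have -> : L f = -1 *: g + 0 by rewrite -E scaleN1r opprK addr0.
  apply: l2_lin => //; apply: (fin_supp_l2 (e := e)) => //.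
  by exists 0%N.
apply/funext => x; apply: (mulIf (x := theta x)); first by rewrite gt_eqF.
have dx : fin_supp e (fun y => (y == x)%:R : R) by exact: fin_supp_delta eK x.
have := h _ dx; rewrite -laplacian_adjoint//.
by rewrite !(l2_ip_delta _ eK idxK).
Qed.

Lemma fin_supp_dom f : fin_supp e f -> laplacian_dom G theta f.
Proof.
move=> ff; split; first exact: fin_supp_l2 ff.
have [M [_ LM _ _]] := fin_supp_bound ff.
by apply: (fin_supp_l2 (e := e)) => //; exists M.
Qed.

Lemma lambda0_ess_eq0 :
  (forall s f, 0 <= s -> l2 theta f -> L f = s *: f -> f = 0) ->
  (forall r, 0 < r -> exists2 f, fin_supp e f & ip (- L f) f < r * ip f f) ->
  lambda0_ess G theta = 0%E.
Proof.
move=> inj small.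
apply: (@ess_spectrum_bottom_eq0 R (V -> R) _ _ (fin_supp e) ip) => //.
- exact: fin_supp_dom.
- by move=> f [].
- move=> f [_ lf]; have -> : - L f = -1 *: L f + 0 by rewrite scaleN1r addr0.
  by apply: l2_lin => //; apply: (fin_supp_l2 (e := e)) => //; exists 0%N.
- by exists 0%N.
- by move=> a f g; exact: l2_lin.
- move=> a f g [lf lLf] [lg lLg]; split; first exact: l2_lin.
  by rewrite laplacian_lin; exact: l2_lin.
- exact: fin_supp_lin.
- by move=> a f g; rewrite laplacian_lin opprD scalerN.
- exact: l2_ipC.
- exact: l2_ip_lin.
- exact: l2_ip_ge0.
- by move=> f; exact: l2_ip_eq0.
- by move=> u; exact: l2_complete.
- by move=> f g _; exact: laplacian_adjoint.
- exact: laplacian_weak.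
- exact: laplacian_form_ge0.
- move=> s f s0 [lf _] h; apply: (inj s) => //; apply/eqP.
  by rewrite -subr_eq0 -oppr_eq0 opprB addrC h.
- exact: l2_normE.
Qed.

(** * Connected components, their mass and the maximum principle *)

Definition set_component (B : set V) (x : V) : set V := [set z | exists p,
  [/\ path (adj G) x p, last x p = z & forall w, w \in x :: p -> B w]].

Lemma set_component_refl B x : B x -> set_component B x x.
Proof. by move=> Bx; exists [::]; split=> // w; rewrite inE => /eqP ->. Qed.

Lemma set_component_sub B x : set_component B x `<=` B.
Proof. by move=> _ [p [_ <- Bp]]; apply: Bp; exact: mem_last. Qed.

Lemma set_component_step B x y z :
  set_component B x y -> adj G y z -> B z -> set_component B x z.
Proof.
move=> [p [xp <- Bp]] yz Bz; exists (rcons p z); split.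
- by rewrite rcons_path xp.
- by rewrite last_rcons.
- by move=> w; rewrite -rcons_cons mem_rcons inE => /predU1P[->|/Bp].
Qed.

Lemma set_component_connected B x : graph_connected (adj G) (set_component B x).
Proof.
have prefix p w : path (adj G) x p -> (forall w, w \in x :: p -> B w) ->
    w \in x :: p -> set_component B x w.
  move=> xp Bp wp; case/splitPl: wp xp Bp => p1 p2 lw; rewrite cat_path => /andP[xp1 _] Bp.
  by exists p1; split=> // v vp; apply: Bp; rewrite -cat_cons mem_cat vp.
move=> y z [p [xp ly Bp]] [q [xq lz Bq]].
have lr : last y (rev (belast x p)) = x.
  by rewrite -ly; case: p {xp ly Bp} => //= a p; rewrite rev_cons last_rcons.
(* Walk back from [y] to [x] along the reversed [p], then on to [z]; every vertex met is reached
   from [x] by a prefix of [p] or [q]. *)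
exists (rev (belast x p) ++ q); split.
- rewrite cat_path lr xq andbT -ly rev_path.
  by rewrite (eq_path (e' := adj G))// => a b; rewrite adj_sym.
- by rewrite last_cat lr.
- move=> w; rewrite mem_cat mem_rev => /orP[wp|wq].
    by apply: (prefix p) => //; exact: mem_belast.
  by apply: (prefix q) => //; rewrite inE wq orbT.
Qed.

Let mass (U : set V) n := \sum_(i < n | `[< U (e i) >]) theta (e i).

Lemma esum_enum (U : set V) :
  \esum_(x in U) (theta x)%:E =
  (\big[+%E/0%R]_(0 <= i <oo | `[< U (e i) >]) (theta (e i))%:E)%E.
Proof.
rewrite nneseries_esum; last by move=> n _; rewrite lee_fin ltW.
apply: reindex_esum; split.
- by move=> i /= /asboolP.
- by move=> i j _ _ /(congr1 idx); rewrite !eK.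
- by move=> x Ux; exists (idx x) => /=; [apply/asboolP; rewrite idxK|exact: idxK].
Qed.

Lemma mass_le_esum U n : ((mass U n)%:E <= \esum_(x in U) (theta x)%:E)%E.
Proof.
rewrite esum_enum /mass -sumEFin -(big_mkord (fun i => `[< U (e i) >])
  (fun i => (theta (e i))%:E)).
by apply: nneseries_lim_ge => i _ _; rewrite lee_fin ltW.
Qed.

Lemma esum_le_mass U K : (forall n, mass U n <= K) ->
  (\esum_(x in U) (theta x)%:E <= K%:E)%E.
Proof.
move=> UK; rewrite esum_enum; apply: lime_le.
  by apply: is_cvg_nneseries_cond => i _ _; rewrite lee_fin ltW.
by apply: nearW => n; rewrite sumEFin lee_fin big_mkord; exact: UK.
Qed.

Lemma seq_argmax (f : V -> R) (x : V) (s : seq V) : x \in s ->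
  exists2 z, z \in s & forall y, y \in s -> f y <= f z.
Proof.
elim: s x => // a [|b s] IH x _.
  by exists a; [rewrite mem_head|move=> y; rewrite inE => /eqP ->].
have [z zs fz] := IH b (mem_head _ _); have [az|za] := leP (f a) (f z).
  exists z; first by rewrite inE zs orbT.
  by move=> y; rewrite inE => /predU1P[->//|/fz].
exists a; first exact: mem_head.
by move=> y; rewrite inE => /predU1P[->//|/fz /le_trans]; apply; exact: ltW.
Qed.

Hypothesis theta_infinite : forall U : set V, infinite_set U ->
  graph_connected (adj G) U -> \esum_(x in U) (theta x)%:E = +oo%E.

(* Maximum principle: if [f x > 0], the component of [x] in [f >= f x] is
   infinite, hence has infinite mass, and [f] is not square-summable. *)
Lemma subharmonic_l2_le0 s f : 0 <= s -> l2 theta f -> L f = s *: f ->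
  forall x, f x <= 0.
Proof.
move=> s0 lf Lf x; rewrite leNgt; apply/negP => fx.
pose U := set_component [set z | f x <= f z] x.
have Ux : U x by apply: set_component_refl => /=.
have Uinf : infinite_set U.
  move=> /finite_seqP[t tE].
  have xt : x \in t by have := Ux; rewrite tE.
  have [z zt fz] := seq_argmax f xt.
  have Uz : U z by rewrite tE.
  (* Where the maximum over [U] is attained, [L f w = s * f w >= 0] forces every neighbour to share
     the value. Neighbours outside the level set are below [f x], hence below the maximum. *)
  have step w y : U w -> f w = f z -> adj G w y -> U y /\ f y = f z.
    move=> Uw wz wy.
    have fle v : adj G w v -> f v <= f w.
      move=> wv; have [xv|/ltW vx] := leP (f x) (f v).
        rewrite wz; apply: fz; have : U v by exact: set_component_step wv xv.
        by rewrite tE.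
      by apply: le_trans vx _; exact: (set_component_sub Uw).
    have fyw : f y = f w.
      apply/eqP; rewrite eq_le fle//= leNgt; apply/negP => lt.
      have [N hN] := adj_bound w.
      have : 0 <= L f w * theta w.
        rewrite Lf mulr_ge0//; last exact: ltW.
        change (0 <= s * f w); rewrite mulr_ge0// (le_trans (ltW fx))//.
        exact: (set_component_sub Uw).
      rewrite (@laplacianE _ _ N); last by move=> v wv _; exact: hN.
      rewrite (bigD1 (Ordinal (hN y wy)))//= idxK leNgt => /negP; apply.
      rewrite -[ltRHS]addr0; apply: ltr_leD.
        by rewrite pmulr_rlt0 ?subr_lt0//; apply/weight_gt0.
      apply: sumr_le0 => i _; have [wi|/weight_eq0 ->] := boolP (adj G w (e i)).
        by rewrite mulr_ge0_le0 ?weight_ge0// subr_le0 fle.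
      by rewrite mul0r.
    split; last by rewrite fyw.
    apply: set_component_step wy _ => //=.
    by rewrite fyw; exact: (set_component_sub Uw).
  (* The maximum spreads along paths from [z], so the finite set [U] would be all of [V]. *)
  apply: (wg_infinite G); apply: (@sub_finite_set _ _ U); last first.
    by rewrite tE; exact: finite_seq.
  move=> v _; have [p [zp <- _]] := @wg_connected _ _ G z v I I.
  suff : forall w, U w -> f w = f z -> path (adj G) w p -> U (last w p).
    by apply.
  elim: p {zp} => // a p IH w Uw wz /= /andP[wa ap].
  by have [Ua az] := step _ _ Uw wz wa; exact: IH.
have := theta_infinite Uinf (@set_component_connected _ _).
(* Chebyshev's inequality, with [f >= f x > 0] on [U]. *)
have : (\esum_(y in U) (theta y)%:E <= (ip f f / f x ^+ 2)%:E)%E.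
  apply: esum_le_mass => n; rewrite ler_pdivlMr ?exprn_gt0//.
  apply: le_trans (l2_partial_le theta_gt0 eK idxK n lf).
  rewrite /mass /series/= big_mkord big_distrl/= big_mkcond/=.
  apply: ler_sum => i _; case: asboolP => [/set_component_sub /= h|_].
    rewrite /l2_term mulrC ler_wpM2r ?(ltW (theta_gt0 _))// -expr2.
    by rewrite ler_sqr ?nnegrE// ?(ltW fx)// (le_trans (ltW fx)).
  exact: l2_term_ge0.
by move=> /[swap] ->; rewrite leye_eq.
Qed.

Lemma nonneg_eigenfunction_eq0 s f : 0 <= s -> l2 theta f -> L f = s *: f ->
  f = 0.
Proof.
move=> s0 lf Lf; apply/funext => x; apply/eqP; rewrite eq_le.
rewrite (subharmonic_l2_le0 s0 lf Lf)/=.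
have l0 : l2 theta 0 by apply: (fin_supp_l2 (e := e)) => //; exists 0%N.
have lN : l2 theta (-1 *: f + 0) by exact: l2_lin.
have LN : L (-1 *: f + 0) = s *: (-1 *: f + 0).
  have L0 : L 0 = 0.
    have := laplacian_lin 1 0 0; rewrite !scale1r addr0 => h.
    by apply: (addIr (L 0)); rewrite add0r -h.
  by rewrite laplacian_lin L0 Lf !addr0 !scalerA mulrC.
have := subharmonic_l2_le0 s0 lN LN x; rewrite addr0 scaleN1r.
by change (- f x <= 0 -> 0 <= f x); rewrite oppr_le0.
Qed.

End GraphLaplacian.

(** * Test functions under subexponential growth *)

(** Doubling at every step of length [d] would give [v (k d) >= 2^k v 0], whereas the growth rate
    [ln (3 / 2) / d] allows at most [(3 / 2)^k] for large [k]. *)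
Lemma subexponential_doubling (R : realType) (v : R -> R) (d : R) : 0 < d ->
  0 < v 0 ->
  (forall a, 0 < a -> exists r0, forall r, r0 <= r -> v r <= expR (a * r)) ->
  exists2 t, 0 <= t & v (t + d) <= 2 * v t.
Proof.
move=> d0 v0 sub; apply: contrapT => nt.
have dbl t : 0 <= t -> 2 * v t < v (t + d).
  by move=> t0; rewrite ltNge; apply/negP => h; apply: nt; exists t.
have vk k : 2 ^+ k * v 0 <= v (k%:R * d).
  elim: k => [|k IH]; first by rewrite expr0 mul1r mul0r.
  rewrite -[k.+1%:R]natr1 mulrDl mul1r exprS -mulrA.
  have kd : 0 <= k%:R * d by rewrite mulr_ge0// ltW.
  by apply: le_trans (ltW (dbl _ kd)); rewrite ler_wpM2l.
have ln_gt : 0 < ln (3 / 2 : R) by rewrite ln_gt0//; lra.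
have [r0 hr0] := sub (ln (3 / 2) / d) (divr_gt0 ln_gt d0).
have bern k : k%:R / 3 <= (4 / 3 : R) ^+ k.
  have : 1 + k%:R / 3 <= (4 / 3 : R) ^+ k.
    elim: k => [|k IH]; first by rewrite mul0r addr0 expr0.
    rewrite exprS -[k.+1%:R]natr1.
    have k0 : 0 <= k%:R :> R by [].
    by move: IH; move: (_ ^+ k) (k%:R) k0 => x y y0 IH; lra.
  by move=> h; apply: le_trans h; rewrite lerDr.
(* The first summand brings [k d] beyond [r0], the second makes [(4 / 3)^k >= k / 3] exceed
   [1 / v 0]. *)
pose k := (Num.truncn `|r0 / d|).+1 + (Num.truncn (3 / v 0)).+1.
have rk : r0 <= k%:R * d.
  rewrite -ler_pdivrMr// (le_trans (ler_norm _))// ltW//.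
  apply: lt_le_trans (truncnS_gt _) _; by rewrite ler_nat leq_addr.
have kv : 3 / v 0 < k%:R.
  by apply: lt_le_trans (truncnS_gt _) _; rewrite ler_nat leq_addl.
have : v (k%:R * d) <= (3 / 2) ^+ k.
  have -> : (3 / 2 : R) ^+ k = expR (ln (3 / 2) / d * (k%:R * d)).
    rewrite mulrCA -mulrA mulVf ?gt_eqF// mulr1 mulrC.
    rewrite mulrC expRM_natl lnK// posrE; lra.
  exact: hr0.
move=> /(le_trans (vk k)) h.
have : (4 / 3 : R) ^+ k * v 0 <= 1.
  have -> : (4 / 3 : R) = 2 / (3 / 2) by field.
  by rewrite expr_div_n mulrAC ler_pdivrMr ?mul1r// exprn_gt0//; lra.
have := bern k; rewrite ltr_pdivrMr// in kv.
move: (_ ^+ k) kv => x; nra.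
Qed.

Lemma clamp_lipschitz (R : realFieldType) (h a b d : R) : `|a - b| <= d ->
  `|Num.min h (Num.max 0 a) - Num.min h (Num.max 0 b)| <= d.
Proof.
rewrite !ler_norml => /andP[? ?].
by case: (leP 0 a) => ?; case: (leP 0 b) => ?; case: (leP h a) => ?;
  case: (leP h b) => ?; case: (leP h 0) => ?; apply/andP; split; lra.
Qed.

Section TestFunctions.
Context {R : realType} {V : countType}.
Variables (G : weighted_graph R V).
Variables (theta : V -> R) (e : nat -> V) (idx : V -> nat).
Variables (rho : V -> V -> R) (x0 : V).
Hypothesis theta_gt0 : forall x, 0 < theta x.
Hypothesis eK : cancel e idx.
Hypothesis idxK : cancel idx e.
Hypothesis theta_infinite : forall U : set V, infinite_set U ->
  graph_connected (adj G) U -> \esum_(x in U) (theta x)%:E = +oo%E.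
Hypothesis rho_metric : is_metric rho.
Hypothesis rho_adapted : adapted G theta rho.
Hypothesis growth0 : volume_growth theta rho x0 = 0%E.

Local Notation L := (laplacian G theta).
Local Notation ip := (l2_ip theta e).
Local Notation vol := (volume theta rho x0).

Let esum_sub (U W : set V) : U `<=` W ->
  (\esum_(x in U) (theta x)%:E <= \esum_(x in W) (theta x)%:E)%E.
Proof.
move=> UW; rewrite esum_mkcond [leRHS]esum_mkcond; apply: le_esum => i _.
case: ifPn => [/set_mem/UW/mem_set ->//|_]; case: ifPn => // _.
by rewrite lee_fin ltW.
Qed.

Lemma volume_le r s : r <= s -> (vol r <= vol s)%E.
Proof. by move=> rs; apply: esum_sub => x /= /le_trans; apply. Qed.

Lemma volume_subexp a : 0 < a ->
  exists r0, forall r, r0 <= r -> (vol r <= (expR (a * r))%:E)%E.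
Proof.
move=> a0; have : (volume_growth theta rho x0 < a%:E)%E by rewrite growth0 lte_fin.
move=> /ereal_inf_lt[_ [A [M [_ MA]] <-] Aa].
(* This makes [r] exceed [M] and also be positive, as needed to multiply by [r]. *)
exists (Num.max M 0 + 1) => r rM.
have r0 : 0 < r by apply: lt_le_trans rM; rewrite ltr_pwDr// le_max lexx orbT.
have Mr : M < r by apply: lt_le_trans rM; rewrite ltr_pwDr// le_max lexx.
have : ((r^-1)%:E * lne (vol r) < a%:E)%E.
  by apply: le_lt_trans Aa; apply: ereal_sup_ubound; exists r => //; exact: MA.
case: (vol r) => [v| |] /=; last by rewrite leNye.
- case: (leP v 0) => [v0 _|v0].
    by rewrite lee_fin (le_trans v0)// expR_ge0.
  rewrite -EFinM lte_fin mulrC ltr_pdivrMr// => h.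
  by rewrite lee_fin -[v]lnK ?posrE// ler_expR ltW.
- by rewrite gt0_muley ?lte_fin ?invr_gt0// ltNge leey.
Qed.

Lemma volume_fin r : vol r \is a fin_num.
Proof.
rewrite ge0_fin_numE; last by apply: esum_ge0 => x _; rewrite lee_fin ltW.
have [r0 hr0] := volume_subexp ltr01.
apply: le_lt_trans (@volume_le r (Num.max r0 r) _) _; first by rewrite le_max lexx orbT.
by apply: le_lt_trans (hr0 _ _) (ltry _); rewrite le_max lexx.
Qed.

Let v r := fine (vol r).
Let vE r : vol r = (v r)%:E. Proof. by rewrite fineK// volume_fin. Qed.

Lemma volume_gt0 r : 0 <= r -> 0 < v r.
Proof.
move=> r0; rewrite -lte_fin -vE.
apply: (@lt_le_trans _ _ (theta x0)%:E); first by rewrite lte_fin.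
apply: esum_ge; exists [set x0]; last by rewrite fsbig_set1.
split; first exact: finite_set1.
by move=> x /= ->; have [_ /(_ x0 x0)[_ ->]//] := rho_metric.
Qed.

Lemma mass_volume_le r n :
  \sum_(i < n | `[< rho x0 (e i) <= r >]) theta (e i) <= v r.
Proof.
rewrite -lee_fin -vE.
exact: (mass_le_esum theta_gt0 eK idxK [set x | rho x0 x <= r] n).
Qed.

Lemma finite_bound (U : set V) : finite_set U ->
  exists N, forall i, (N <= i)%N -> ~ U (e i).
Proof.
move=> /finite_seqP[s ->]; exists (\max_(y <- s) idx y).+1 => i si /= is_.
have := @leq_bigmax_seq _ _ xpredT idx _ is_ isT.
by rewrite eK leqNgt si.
Qed.

(** The ball itself may be infinite, but its volume is finite, whereas an infinite component would
    have infinite mass. *)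
Lemma finite_component r x :
  finite_set (set_component G [set y | rho x0 y <= r] x).
Proof.
apply: contrapT => /theta_infinite /(_ (@set_component_connected _ _ _ _ _)) h.
have := esum_sub (@set_component_sub _ _ G [set y | rho x0 y <= r] x).
by rewrite h leye_eq -/(vol r) vE.
Qed.

Lemma small_energy r : 0 < r ->
  exists2 f, fin_supp e f & ip (- L f) f < r * ip f f.
Proof.
move=> r0; have [rho_ge0 rho0 rhoC rhoT] := rho_metric.
have [adapt [c c0 rho_c]] := rho_adapted.
(* [h] is chosen to make the final bound [2 / h^2] on the Rayleigh quotient smaller than [r]. *)
pose h := 2 / r + 1.
have h0 : 0 < h by rewrite ltr_wpDl// ltW// divr_gt0.
have rh : 2 < r * h ^+ 2.
  have : r * (2 / r) = 2 by rewrite mulrC divfK// gt_eqF.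
  rewrite /h; have : 0 < 2 / r by exact: divr_gt0.
  by move: (2 / r) => x; nra.
(* The test function decays over a width [h], and edges touching its support reach at most [c]
   further. *)
have [|||t t0 vt] := @subexponential_doubling R v (h + c).
- exact: addr_gt0.
- exact: volume_gt0.
- move=> a /volume_subexp[q hq]; exists q => s /hq; by rewrite vE lee_fin.
pose B := [set y | rho x0 y <= t + h].
(* The first [N] vertices carry more than half of the volume of the ball of radius [t], so the
   finitely many components through them suffice. *)
have [N hN] : exists N, v t / 2 < \sum_(i < N | `[< rho x0 (e i) <= t >]) theta (e i).
  apply: contrapT => nN; have := volume_gt0 t0.
  suff : v t <= v t / 2 by lra.
  rewrite -lee_fin -vE; apply: (esum_le_mass theta_gt0 eK idxK) => n.
  by rewrite leNgt; apply/negP => hn; apply: nN; exists n.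
pose U := \bigcup_(i in `I_N) set_component G B (e i).
have Ufin : finite_set U.
  by apply: bigcup_finite => [|i _]; [exact: finite_II|exact: finite_component].
pose f y := Num.min h (Num.max 0 (t + h - rho x0 y)).
pose g y := if `[< U y >] then f y else 0.
have UB y : U y -> B y by move=> [i _ /set_component_sub].
have Ustep y z : U y -> adj G y z -> B z -> U z.
  by move=> [i iN Uy] yz Bz; exists i => //; exact: set_component_step yz Bz.
have f_out y : ~ B y -> f y = 0.
  move=> /negP; rewrite -ltNge => yB; rewrite /f (max_idPl _).
    by rewrite (min_idPr _)// ltW.
  lra.
(* Cutting down to [U] keeps the Lipschitz bound: an edge leaving [U] also leaves [B], and [f]
   vanishes there. *)
have g_lip y z : adj G y z -> (g y - g z) ^+ 2 <= rho y z ^+ 2.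
  move=> yz.
  have f_lip : (f y - f z) ^+ 2 <= rho y z ^+ 2.
    have h1 := rhoT x0 y z; have h2 := rhoT x0 z y; rewrite (rhoC z y) in h2.
    have h3 := rho_ge0 y z.
    rewrite -[leLHS]real_normK ?num_real// ler_sqr ?nnegrE//.
    by apply: clamp_lipschitz; rewrite ler_norml; apply/andP; split; lra.
  rewrite /g; case: asboolP => Uy; case: asboolP => Uz //.
  - rewrite -(f_out z)//; apply: contra_not Uz; exact: Ustep Uy yz.
  - rewrite -(f_out y)//; apply: contra_not Uy; apply: Ustep Uz _.
    by rewrite adj_sym.
  - by rewrite subrr expr0n/= sqr_ge0.
have g_fin : fin_supp e g.
  have [n hn] := finite_bound Ufin; exists n => i /hn ni; rewrite /g.
  by case: asboolP.
exists g => //.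
have E : ip (- L g) g <= v t.
  have [M0 /(_ _ (leqnn _)) ->] := laplacian_energy G theta_gt0 eK idxK g_fin.
  (* Adaptedness bounds the inner sum by [theta (e i)]. Beyond radius [t + h + c] it is 0, since
     both ends of each edge lie outside [B]. *)
  have : \sum_(i < M0) \sum_(j < M0) weight G (e i) (e j) * (g (e j) - g (e i)) ^+ 2
      <= v (t + (h + c)).
    apply: le_trans (mass_volume_le _ M0).
    rewrite [leRHS]big_mkcond/=; apply: ler_sum => i _; case: asboolP => iB.
      have [n hn] := adj_bound G idx (e i).
      apply: (@le_trans _ _ (\sum_(j < maxn M0 n) weight G (e i) (e j) * rho (e i) (e j) ^+ 2)).
        rewrite (big_ord_widen _ (fun j => weight G (e i) (e j) *
          (g (e j) - g (e i)) ^+ 2) (leq_maxl M0 n)) big_mkcond/=.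
        apply: ler_sum => j _; case: ifP => _.
          have [ij|/weight_eq0 ->] := boolP (adj G (e i) (e j)); last by rewrite !mul0r.
          by rewrite ler_wpM2l ?weight_ge0// -sqrrN opprB g_lip.
        by rewrite mulr_ge0 ?weight_ge0// sqr_ge0.
      rewrite -(fsbig_adjE eK idxK (F := fun y => rho (e i) y ^+ 2)).
        by have := adapt (e i); rewrite mulrC ler_pdivrMr// mul1r.
      by move=> y iy _; rewrite leq_max hn// orbT.
    rewrite big1// => j _.
    have [ij|/weight_eq0 ->] := boolP (adj G (e i) (e j)); last by rewrite mul0r.
    have g0 y : t + h < rho x0 y -> g y = 0.
      by move=> yB; rewrite /g; case: asboolP => // /UB; rewrite /B/= leNgt yB.
    have := rho_c _ _ ij; have := rhoT x0 (e j) (e i); rewrite (rhoC (e j) (e i)).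
    move/negP: iB; rewrite -ltNge => iB h1 h2.
    by rewrite !g0 ?subrr ?expr0n ?mulr0//; lra.
  by move=> h1; have := le_trans h1 vt; lra.
(* [g] equals [h] at those of the first [N] vertices that lie within radius [t]. *)
have F : h ^+ 2 * (v t / 2) < ip g g.
  apply: lt_le_trans (l2_partial_le theta_gt0 eK idxK N (fin_supp_l2 theta_gt0 eK idxK g_fin)).
  apply: (@lt_le_trans _ _ (h ^+ 2 * \sum_(i < N | `[< rho x0 (e i) <= t >]) theta (e i))).
    by rewrite ltr_pM2l// exprn_gt0.
  rewrite /series/= big_mkord big_distrr/= big_mkcond/=; apply: ler_sum => i _.
  case: asboolP => [ti|_]; last exact: l2_term_ge0.
  have Bi : B (e i) by rewrite /B/=; lra.
  have Ui : U (e i) by exists i => //=; exact: set_component_refl.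
  rewrite /l2_term /g; case: asboolP => // _.
  rewrite /f (max_idPr _); last lra.
  by rewrite (min_idPl _) ?expr2//; lra.
apply: (le_lt_trans E); have := volume_gt0 t0 => v0.
apply: (@lt_trans _ _ (r * (h ^+ 2 * (v t / 2)))); last by rewrite ltr_pM2l.
have : 2 * (v t / 2) < r * h ^+ 2 * (v t / 2) by rewrite ltr_pM2r// divr_gt0.
lra.
Qed.

End TestFunctions.

Theorem corollary1p5 (R : realType) (V : countType) (G : weighted_graph R V)
    (theta : V -> R) (x0 : V)
    (theta_gt0 : forall x : V, 0 < theta x)
    (theta_infinite : forall U : set V,
       infinite_set U -> graph_connected (adj G) U ->
       \esum_(x in U) (theta x)%:E = +oo%E) :
  (exists rho : V -> V -> R,
     [/\ is_metric rho, adapted G theta rho &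
         volume_growth theta rho x0 = 0%E]) ->
  lambda0_ess G theta = 0%E.
Proof.
move=> [rho [rho_metric rho_adapted growth0]].
have /card_set_bijP[idx] := eq_card_nat (countableP _) (wg_infinite G).
rewrite setTT_bijective => -[e idxK eK].
apply: (lambda0_ess_eq0 theta_gt0 eK idxK).
  by move=> s f; exact: (nonneg_eigenfunction_eq0 theta_gt0 eK idxK theta_infinite).
exact: (small_energy theta_gt0 eK idxK theta_infinite rho_metric rho_adapted growth0).
Qed.
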